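(* Let $\mathscr{B}$ and $\mathscr{C}$ be bicategories with shadows, $F,G\colon\mathscr{B}\to\mathscr{C}$ lax functors, and $\alpha\colon F\to G$ a conjunctional transformation. Let $M\in\mathscr{B}(R,S)$ be right dualizable with right dual $M^{\bigstar}$, and suppose that $F$ and $G$ preserve its dual $M^{\bigstar}$. (i) Then $\alpha_M\colon F(M)\odot\alpha_S\to\alpha_R\odot G(M)$ is an isomorphism, whose inverse is the mate of $\alpha_{M^{\bigstar}}\colon F(M^{\bigstar})\odot\alpha_R\to\alpha_S\odot G(M^{\bigstar})$ under the dual pairs $(F(M),F(M^{\bigstar}))$ and $(G(M),G(M^{\bigstar}))$. (ii) Assume furthermore that $P\in\mathscr{B}(S,S)$ is such that $\mathfrak{c}\colon F(M)\odot F(P)\to F(M\odot P)$ and $\mathfrak{c}\colon G(M)\odot G(P)\to G(M\odot P)$ are isomorphisms. Then for any $Q\in\mathscr{B}(R,R)$ and any 2-cell $f\colon Q\odot M\to M\odot P$, $$\operatorname{tr}(\alpha_P)\circ\operatorname{tr}(\mathfrak{c}^{-1}\circ F(f)\circ\mathfrak{c})=\operatorname{tr}(\mathfrak{c}^{-1}\circ G(f)\circ\mathfrak{c})\circ\operatorname{tr}(\alpha_Q)$$ as morphisms $\langle\!\langle F(Q)\rangle\!\rangle\to\langle\!\langle G(P)\rangle\!\rangle$.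
   Context: Bicategories. A bicategory $\mathscr{B}$ has 0-cells, hom-categories $\mathscr{B}(R,S)$ (objects: 1-cells; morphisms: 2-cells), units $U_R\in\mathscr{B}(R,R)$, composition functors $\odot\colon\mathscr{B}(R,S)\times\mathscr{B}(S,T)\to\mathscr{B}(R,T)$ in diagrammatic order, and coherent natural isomorphisms $\mathfrak{a}\colon M\odot(N\odot P)\to(M\odot N)\odot P$, $\mathfrak{l}\colon U_R\odot M\to M$, $\mathfrak{r}\colon M\odot U_S\to M$; these are suppressed from composites below. Shadow functor (a ''bicategory with shadows'' is one equipped with a shadow functor). It consists of functors $\langle\!\langle-\rangle\!\rangle\colon\mathscr{B}(R,R)\to\mathbf{T}$ for every 0-cell $R$ (with $\mathbf{T}$ a fixed category) and natural isomorphisms $\theta\colon\langle\!\langle M\odot N\rangle\!\rangle\to\langle\!\langle N\odot M\rangle\!\rangle$ for $M\in\mathscr{B}(R,S)$, $N\in\mathscr{B}(S,R)$, such that, whenever it makes sense: the composite $\langle\!\langle (M\odot N)\odot P\rangle\!\rangle\xrightarrow{\theta}\langle\!\langle P\odot(M\odot N)\rangle\!\rangle\xrightarrow{\langle\!\langle\mathfrak{a}\rangle\!\rangle}\langle\!\langle(P\odot M)\odot N\rangle\!\rangle$ equals $\langle\!\langle (M\odot N)\odot P\rangle\!\rangle\xrightarrow{\langle\!\langle\mathfrak{a}^{-1}\rangle\!\rangle}\langle\!\langle M\odot (N\odot P)\rangle\!\rangle\xrightarrow{\theta}\langle\!\langle (N\odot P)\odot M\rangle\!\rangle\xrightarrow{\langle\!\langle\mathfrak{a}^{-1}\rangle\!\rangle}\langle\!\langle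 N\odot(P\odot M)\rangle\!\rangle\xrightarrow{\theta}\langle\!\langle(P\odot M)\odot N\rangle\!\rangle$; and $\langle\!\langle\mathfrak{l}\rangle\!\rangle\circ\theta=\langle\!\langle\mathfrak{r}\rangle\!\rangle$ on $\langle\!\langle M\odot U_R\rangle\!\rangle$ and $\langle\!\langle\mathfrak{r}\rangle\!\rangle\circ\theta=\langle\!\langle\mathfrak{l}\rangle\!\rangle$ on $\langle\!\langle U_R\odot M\rangle\!\rangle$. Duality. $M\in\mathscr{B}(R,S)$ is right dualizable with right dual $M^{\bigstar}\in\mathscr{B}(S,R)$ (and $(M,M^{\bigstar})$ is a dual pair) if there are $\eta\colon U_R\to M\odot M^{\bigstar}$ and $\varepsilon\colon M^{\bigstar}\odot M\to U_S$ satisfying $(\mathrm{id}_M\odot\varepsilon)(\eta\odot\mathrm{id}_M)=\mathrm{id}_M$ and $(\varepsilon\odot\mathrm{id}_{M^{\bigstar}})(\mathrm{id}_{M^{\bigstar}}\odot\eta)=\mathrm{id}_{M^{\bigstar}}$. Trace. For $M\in\mathscr{B}(R,S)$ right dualizable, $Q\in\mathscr{B}(R,R)$, $P\in\mathscr{B}(S,S)$ and $f\colon Q\odot M\to M\odot P$, the trace $\operatorname{tr}(f)$ is the composite $$\langle\!\langle Q\rangle\!\rangle\xrightarrow{\langle\!\langle\mathrm{id}\odot\eta\rangle\!\rangle}\langle\!\langle Q\odot M\odot M^{\bigstar}\rangle\!\rangle\xrightarrow{\langle\!\langle f\odot\mathrm{id}\rangle\!\rangle}\langle\!\langle M\odot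 P\odot M^{\bigstar}\rangle\!\rangle\xrightarrow{\theta}\langle\!\langle M^{\bigstar}\odot M\odot P\rangle\!\rangle\xrightarrow{\langle\!\langle\varepsilon\odot\mathrm{id}\rangle\!\rangle}\langle\!\langle P\rangle\!\rangle,$$ independent of the choice of dual. Lax functor. $F\colon\mathscr{B}\to\mathscr{C}$ consists of a function on 0-cells, functors $F\colon\mathscr{B}(R,S)\to\mathscr{C}(F(R),F(S))$, and natural transformations $\mathfrak{c}_{M,N}\colon F(M)\odot F(N)\to F(M\odot N)$ and $\mathfrak{i}\colon U_{F(R)}\to F(U_R)$ with $\mathfrak{c}\circ(\mathfrak{c}\odot\mathrm{id})\circ\mathfrak{a}=F(\mathfrak{a})\circ\mathfrak{c}\circ(\mathrm{id}\odot\mathfrak{c})$, $F(\mathfrak{l})\circ\mathfrak{c}\circ(\mathfrak{i}\odot\mathrm{id})=\mathfrak{l}$, $F(\mathfrak{r})\circ\mathfrak{c}\circ(\mathrm{id}\odot\mathfrak{i})=\mathfrak{r}$. We write $\mathfrak{c},\mathfrak{i}$ (or $\mathfrak{i}^F,\mathfrak{i}^G$) for the constraints of both $F$ and $G$. Preserving a dual. $F$ preserves the dual $M^{\bigstar}$ of $M\in\mathscr{B}(R,S)$ if $\mathfrak{c}\colon F(M)\odot F(M^{\bigstar})\to F(M\odot M^{\bigstar})$ and $\mathfrak{i}\colon U_{F(S)}\to F(U_S)$ are isomorphisms. Then $(F(M),F(M^{\bigstar}))$ is a dual pair with coevaluation $\mathfrak{c}^{-1}\circ F(\eta)\circ\mathfrak{i}\colon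 U_{F(R)}\to F(M)\odot F(M^{\bigstar})$ and evaluation $\mathfrak{i}^{-1}\circ F(\varepsilon)\circ\mathfrak{c}\colon F(M^{\bigstar})\odot F(M)\to U_{F(S)}$; similarly for $G$. Conjunctional transformation. $\alpha\colon F\to G$ consists of: for each 0-cell $R\in\mathscr{B}$, a right dualizable 1-cell $\alpha_R\in\mathscr{C}(F(R),G(R))$ with right dual $\alpha_R^{\bigstar}$; for each 1-cell $M\in\mathscr{B}(R,S)$, a 2-cell $\alpha_M\colon F(M)\odot\alpha_S\to\alpha_R\odot G(M)$; such that (naturality) $\alpha_{N}\circ(F(f)\odot\mathrm{id}_{\alpha_S})=(\mathrm{id}_{\alpha_R}\odot G(f))\circ\alpha_M$ for each 2-cell $f\colon M\to N$ in $\mathscr{B}(R,S)$; (unit) $\alpha_{U_R}\circ(\mathfrak{i}^F\odot\mathrm{id}_{\alpha_R})=\mathrm{id}_{\alpha_R}\odot\mathfrak{i}^G$, using $U_{F(R)}\odot\alpha_R\cong\alpha_R\cong\alpha_R\odot U_{G(R)}$; (composition) for $M\in\mathscr{B}(R,S)$, $N\in\mathscr{B}(S,T)$, $\alpha_{M\odot N}\circ(\mathfrak{c}\odot\mathrm{id}_{\alpha_T})=(\mathrm{id}_{\alpha_R}\odot\mathfrak{c})\circ(\alpha_M\odot\mathrm{id}_{G(N)})\circ(\mathrm{id}_{F(M)}\odot\alpha_N)$. In (i), the mate of $\alpha_{M^{\bigstar}}$ is the composite $\alpha_R\odot G(M)\to F(M)\odot F(M^{\bigstar})\odot\alpha_R\odot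 G(M)\to F(M)\odot\alpha_S\odot G(M^{\bigstar})\odot G(M)\to F(M)\odot\alpha_S$ of the coevaluation of $(F(M),F(M^{\bigstar}))$, then $\mathrm{id}\odot\alpha_{M^{\bigstar}}\odot\mathrm{id}$, then the evaluation of $(G(M),G(M^{\bigstar}))$. In (ii), $\operatorname{tr}(\alpha_Q)\colon\langle\!\langle F(Q)\rangle\!\rangle\to\langle\!\langle G(Q)\rangle\!\rangle$ is the trace of $\alpha_Q\colon F(Q)\odot\alpha_R\to\alpha_R\odot G(Q)$ with respect to the right dualizable $\alpha_R$, and $\operatorname{tr}(\alpha_P)$ is the trace of $\alpha_P$ with respect to $\alpha_S$; the 2-cell $\mathfrak{c}^{-1}\circ F(f)\circ\mathfrak{c}$ means $\mathfrak{c}_{M,P}^{-1}\circ F(f)\circ\mathfrak{c}_{Q,M}\colon F(Q)\odot F(M)\to F(M)\odot F(P)$, traced with respect to $F(M)$, and similarly for $G$. *)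

(* Defs.v *)
Set Implicit Arguments.
Unset Strict Implicit.
Unset Printing Implicit Defensive.

(** * Categories and functors *)

Record Category := {
  obj :> Type;
  hom : obj -> obj -> Type;
  idm : forall A, hom A A;
  compose : forall A B C, hom B C -> hom A B -> hom A C;
  compose_idl : forall A B (f : hom A B), compose (idm B) f = f;
  compose_idr : forall A B (f : hom A B), compose f (idm A) = f;
  compose_assoc : forall A B C D (h : hom C D) (g : hom B C) (f : hom A B),
    compose h (compose g f) = compose (compose h g) f
}.

Arguments hom {_} _ _.
Arguments idm {_} _.
Arguments compose {_ _ _ _} _ _.

Declare Scope cat_scope.
Open Scope cat_scope.
Notation "A ⟶ B" := (hom A B) (at level 90, no associativity) : cat_scope.
Notation "g ∘ f" := (compose g f) (at level 60, right associativity) : cat_scope.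

Definition is_inverse (X : Category) (A B : X) (f : A ⟶ B) (g : B ⟶ A) : Prop :=
  g ∘ f = idm A /\ f ∘ g = idm B.

(* Being an isomorphism carries the (unique) inverse as data, so that it can
   be used in composites. *)
Record is_iso (X : Category) (A B : X) (f : A ⟶ B) := {
  inv : B ⟶ A;
  inv_spec : is_inverse f inv
}.

Record Functor (X Y : Category) := {
  fobj :> X -> Y;
  fmap : forall A B : X, (A ⟶ B) -> (fobj A ⟶ fobj B);
  fmap_id : forall A : X, fmap (idm A) = idm (fobj A);
  fmap_comp : forall (A B C : X) (g : B ⟶ C) (f : A ⟶ B),
    fmap (g ∘ f) = fmap g ∘ fmap f
}.

Arguments fmap {_ _} _ {_ _} _.

(** * Bicategories *)

Reserved Notation "M ⊙ N" (at level 50, left associativity).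
Reserved Notation "f ⊡ g" (at level 50, left associativity).

(* [odot] composes 1-cells in diagrammatic order and [odot2] is its action on
   2-cells; [odot2_id] and [odot2_comp] say that each [odot R S T] is a functor
   on the product category [cell R S * cell S T]. *)
Record Bicategory := {
  cell0 :> Type;
  cell : cell0 -> cell0 -> Category;
  unit1 : forall R, cell R R;
  odot : forall R S T, cell R S -> cell S T -> cell R T
    where "M ⊙ N" := (odot M N);
  odot2 : forall R S T (M M' : cell R S) (N N' : cell S T),
    (M ⟶ M') -> (N ⟶ N') -> (M ⊙ N ⟶ M' ⊙ N')
    where "f ⊡ g" := (odot2 f g);
  odot2_id : forall R S T (M : cell R S) (N : cell S T),
    idm M ⊡ idm N = idm (M ⊙ N);
  odot2_comp : forall R S T (M M' M'' : cell R S) (N N' N'' : cell S T)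
    (f' : M' ⟶ M'') (f : M ⟶ M') (g' : N' ⟶ N'') (g : N ⟶ N'),
    (f' ∘ f) ⊡ (g' ∘ g) = (f' ⊡ g') ∘ (f ⊡ g);

  assoc : forall R S T V (M : cell R S) (N : cell S T) (P : cell T V),
    M ⊙ (N ⊙ P) ⟶ (M ⊙ N) ⊙ P;
  assoc_iso : forall R S T V (M : cell R S) (N : cell S T) (P : cell T V),
    is_iso (assoc M N P);
  assoc_nat : forall R S T V (M M' : cell R S) (N N' : cell S T)
    (P P' : cell T V) (f : M ⟶ M') (g : N ⟶ N') (h : P ⟶ P'),
    assoc M' N' P' ∘ (f ⊡ (g ⊡ h)) = ((f ⊡ g) ⊡ h) ∘ assoc M N P;

  lunit : forall R S (M : cell R S), unit1 R ⊙ M ⟶ M;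
  lunit_iso : forall R S (M : cell R S), is_iso (lunit M);
  lunit_nat : forall R S (M M' : cell R S) (f : M ⟶ M'),
    lunit M' ∘ (idm (unit1 R) ⊡ f) = f ∘ lunit M;

  runit : forall R S (M : cell R S), M ⊙ unit1 S ⟶ M;
  runit_iso : forall R S (M : cell R S), is_iso (runit M);
  runit_nat : forall R S (M M' : cell R S) (f : M ⟶ M'),
    runit M' ∘ (f ⊡ idm (unit1 S)) = f ∘ runit M;

  pentagon : forall R S T V W (M : cell R S) (N : cell S T) (P : cell T V)
    (Q : cell V W),
    assoc (M ⊙ N) P Q ∘ assoc M N (P ⊙ Q)
    = (assoc M N P ⊡ idm Q) ∘ assoc M (N ⊙ P) Q ∘ (idm M ⊡ assoc N P Q);
  triangle : forall R S T (M : cell R S) (N : cell S T),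
    (runit M ⊡ idm N) ∘ assoc M (unit1 S) N = idm M ⊡ lunit N
}.

Arguments cell {_} _ _.
Arguments unit1 {_} _.
Arguments odot {_ _ _ _} _ _.
Arguments odot2 {_ _ _ _ _ _ _ _} _ _.
Arguments assoc {_ _ _ _ _} _ _ _.
Arguments assoc_iso {_ _ _ _ _} _ _ _.
Arguments lunit {_ _ _} _.
Arguments lunit_iso {_ _ _} _.
Arguments runit {_ _ _} _.
Arguments runit_iso {_ _ _} _.

Notation "M ⊙ N" := (odot M N) : cat_scope.
Notation "f ⊡ g" := (odot2 f g) : cat_scope.

Definition assoc_inv (B : Bicategory) (R S T V : B)
  (M : cell R S) (N : cell S T) (P : cell T V) :
  (M ⊙ N) ⊙ P ⟶ M ⊙ (N ⊙ P) := inv (assoc_iso M N P).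
Definition lunit_inv (B : Bicategory) (R S : B) (M : cell R S) :
  M ⟶ unit1 R ⊙ M := inv (lunit_iso M).
Definition runit_inv (B : Bicategory) (R S : B) (M : cell R S) :
  M ⟶ M ⊙ unit1 S := inv (runit_iso M).

(** * Shadows *)

Record Shadow (B : Bicategory) (T : Category) := {
  shadow : forall R : B, Functor (cell R R) T;
  theta : forall (R S : B) (M : cell R S) (N : cell S R),
    shadow R (M ⊙ N) ⟶ shadow S (N ⊙ M);
  theta_iso : forall (R S : B) (M : cell R S) (N : cell S R),
    is_iso (theta M N);
  theta_nat : forall (R S : B) (M M' : cell R S) (N N' : cell S R)
    (f : M ⟶ M') (g : N ⟶ N'),
    theta M' N' ∘ fmap (shadow R) (f ⊡ g)
    = fmap (shadow S) (g ⊡ f) ∘ theta M N;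
  theta_assoc : forall (R S V : B) (M : cell R S) (N : cell S V) (P : cell V R),
    fmap (shadow V) (assoc P M N) ∘ theta (M ⊙ N) P
    = theta N (P ⊙ M) ∘ fmap (shadow S) (assoc_inv N P M)
      ∘ theta M (N ⊙ P) ∘ fmap (shadow R) (assoc_inv M N P);
  theta_runit : forall (R : B) (M : cell R R),
    fmap (shadow R) (lunit M) ∘ theta M (unit1 R) = fmap (shadow R) (runit M);
  theta_lunit : forall (R : B) (M : cell R R),
    fmap (shadow R) (runit M) ∘ theta (unit1 R) M = fmap (shadow R) (lunit M)
}.

Arguments shadow {_ _} _ _.
Arguments theta {_ _} _ {_ _} _ _.

(** * Duality, mates and traces *)

(* The triangle identities are stated with the unit constraints on the right
   hand side, in place of identities. *)
Record RightDual (B : Bicategory) (R S : B) (M : cell R S) := {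
  dual : cell S R;
  coev : unit1 R ⟶ M ⊙ dual;
  ev : dual ⊙ M ⟶ unit1 S;
  dual_triangle : runit M ∘ (idm M ⊡ ev) ∘ assoc_inv M dual M ∘ (coev ⊡ idm M)
    = lunit M;
  dual_triangle' : lunit dual ∘ (ev ⊡ idm dual) ∘ assoc dual M dual
      ∘ (idm dual ⊡ coev)
    = runit dual
}.

Definition mate (B : Bicategory) (R S R' S' : B)
  (M : cell R S) (DM : RightDual M) (N : cell R' S') (DN : RightDual N)
  (X : cell R R') (Y : cell S S')
  (g : dual DM ⊙ X ⟶ Y ⊙ dual DN) : X ⊙ N ⟶ M ⊙ Y :=
  (idm M ⊡ runit Y)
  ∘ (idm M ⊡ (idm Y ⊡ ev DN))
  ∘ (idm M ⊡ assoc_inv Y (dual DN) N)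
  ∘ (idm M ⊡ (g ⊡ idm N))
  ∘ (idm M ⊡ assoc (dual DM) X N)
  ∘ assoc_inv M (dual DM) (X ⊙ N)
  ∘ (coev DM ⊡ idm (X ⊙ N))
  ∘ lunit_inv (X ⊙ N).

Definition trace (B : Bicategory) (T : Category) (sh : Shadow B T) (R S : B)
  (M : cell R S) (D : RightDual M) (Q : cell R R) (P : cell S S)
  (f : Q ⊙ M ⟶ M ⊙ P) : shadow sh R Q ⟶ shadow sh S P :=
  fmap (shadow sh S) (lunit P)
  ∘ fmap (shadow sh S) (ev D ⊡ idm P)
  ∘ fmap (shadow sh S) (assoc (dual D) M P)
  ∘ theta sh (M ⊙ P) (dual D)
  ∘ fmap (shadow sh R) (f ⊡ idm (dual D))
  ∘ fmap (shadow sh R) (assoc Q M (dual D))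
  ∘ fmap (shadow sh R) (idm Q ⊡ coev D)
  ∘ fmap (shadow sh R) (runit_inv Q).

(** * Lax functors *)

Record LaxFunctor (B C : Bicategory) := {
  lax0 :> B -> C;
  lax : forall R S : B, Functor (cell R S) (cell (lax0 R) (lax0 S));
  laxc : forall (R S T : B) (M : cell R S) (N : cell S T),
    lax R S M ⊙ lax S T N ⟶ lax R T (M ⊙ N);
  laxc_nat : forall (R S T : B) (M M' : cell R S) (N N' : cell S T)
    (f : M ⟶ M') (g : N ⟶ N'),
    laxc M' N' ∘ (fmap (lax R S) f ⊡ fmap (lax S T) g)
    = fmap (lax R T) (f ⊡ g) ∘ laxc M N;
  laxi : forall R : B, unit1 (lax0 R) ⟶ lax R R (unit1 R);
  lax_assoc : forall (R S T V : B) (M : cell R S) (N : cell S T) (P : cell T V),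
    laxc (M ⊙ N) P ∘ (laxc M N ⊡ idm (lax T V P))
      ∘ assoc (lax R S M) (lax S T N) (lax T V P)
    = fmap (lax R V) (assoc M N P) ∘ laxc M (N ⊙ P)
      ∘ (idm (lax R S M) ⊡ laxc N P);
  lax_lunit : forall (R S : B) (M : cell R S),
    fmap (lax R S) (lunit M) ∘ laxc (unit1 R) M ∘ (laxi R ⊡ idm (lax R S M))
    = lunit (lax R S M);
  lax_runit : forall (R S : B) (M : cell R S),
    fmap (lax R S) (runit M) ∘ laxc M (unit1 S) ∘ (idm (lax R S M) ⊡ laxi S)
    = runit (lax R S M)
}.

Arguments lax {_ _} _ {_ _}.
Arguments laxc {_ _} _ {_ _ _} _ _.
Arguments laxi {_ _} _ _.

Record PreservesDual (B C : Bicategory) (F : LaxFunctor B C) (R S : B)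
  (M : cell R S) (D : RightDual M) := {
  pres_c : is_iso (laxc F M (dual D));
  pres_i : is_iso (laxi F S)
}.

Lemma compose_eq (X : Category) (A B C D : X) (h : C ⟶ D) (g : B ⟶ C)
  (k : B ⟶ D) (f : A ⟶ B) : h ∘ g = k -> h ∘ g ∘ f = k ∘ f.
Proof. now intros <-; rewrite compose_assoc. Qed.

Lemma lwhisker_comp (B : Bicategory) (R S T : B) (M : cell R S)
  (N N' N'' : cell S T) (g : N' ⟶ N'') (f : N ⟶ N') :
  idm M ⊡ (g ∘ f) = (idm M ⊡ g) ∘ (idm M ⊡ f).
Proof. now rewrite <- odot2_comp, compose_idl. Qed.

Lemma rwhisker_comp (B : Bicategory) (R S T : B) (M M' M'' : cell R S)
  (N : cell S T) (g : M' ⟶ M'') (f : M ⟶ M') :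
  (g ∘ f) ⊡ idm N = (g ⊡ idm N) ∘ (f ⊡ idm N).
Proof. now rewrite <- odot2_comp, compose_idl. Qed.

Lemma lax_assoc_inv (B C : Bicategory) (F : LaxFunctor B C) (R S T V : B)
  (M : cell R S) (N : cell S T) (P : cell T V) :
  laxc F M (N ⊙ P) ∘ (idm (lax F M) ⊡ laxc F N P)
    ∘ assoc_inv (lax F M) (lax F N) (lax F P)
  = fmap (lax F) (assoc_inv M N P) ∘ laxc F (M ⊙ N) P
    ∘ (laxc F M N ⊡ idm (lax F P)).
Proof.
unfold assoc_inv.
destruct (assoc_iso M N P) as [a' [Ha Ha']].
destruct (assoc_iso (lax F M) (lax F N) (lax F P)) as [b' [Hb Hb']]; simpl.
rewrite <- (compose_idl (laxc F M (N ⊙ P) ∘ _)), <- fmap_id, <- Ha, fmap_comp,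
  <- compose_assoc.
f_equal.
rewrite (compose_assoc (laxc F M (N ⊙ P))).
rewrite (compose_assoc (fmap (lax F) (assoc M N P))), <- lax_assoc,
  <- !compose_assoc, Hb', compose_idr.
reflexivity.
Qed.

Definition image_coev (B C : Bicategory) (F : LaxFunctor B C) (R S : B)
  (M : cell R S) (D : RightDual M) (p : PreservesDual F D) :
  unit1 (F R) ⟶ lax F M ⊙ lax F (dual D) :=
  inv (pres_c p) ∘ fmap (lax F) (coev D) ∘ laxi F R.

Definition image_ev (B C : Bicategory) (F : LaxFunctor B C) (R S : B)
  (M : cell R S) (D : RightDual M) (p : PreservesDual F D) :
  lax F (dual D) ⊙ lax F M ⟶ unit1 (F S) :=
  inv (pres_i p) ∘ fmap (lax F) (ev D) ∘ laxc F (dual D) M.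

Lemma image_triangle (B C : Bicategory) (F : LaxFunctor B C) (R S : B)
  (M : cell R S) (D : RightDual M) (p : PreservesDual F D) :
  runit (lax F M) ∘ (idm (lax F M) ⊡ image_ev p)
    ∘ assoc_inv (lax F M) (lax F (dual D)) (lax F M)
    ∘ (image_coev p ⊡ idm (lax F M))
  = lunit (lax F M).
Proof.
unfold image_ev, image_coev.
destruct p as [[ci [Hc Hc']] [ii [Hi Hi']]]; simpl.
assert (E1 : (idm (lax F M) ⊡ laxi F S) ∘ (idm (lax F M) ⊡ ii) = idm _)
  by now rewrite <- lwhisker_comp, Hi', odot2_id.
assert (E2 : laxc F M (unit1 S) ∘ (idm (lax F M) ⊡ fmap (lax F) (ev D))
             = fmap (lax F) (idm M ⊡ ev D) ∘ laxc F M (dual D ⊙ M))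
  by now rewrite <- laxc_nat, fmap_id.
assert (E4 : (laxc F M (dual D) ⊡ idm (lax F M)) ∘ (ci ⊡ idm (lax F M)) = idm _)
  by now rewrite <- rwhisker_comp, Hc', odot2_id.
assert (E5 : laxc F (M ⊙ dual D) M ∘ (fmap (lax F) (coev D) ⊡ idm (lax F M))
             = fmap (lax F) (coev D ⊡ idm M) ∘ laxc F (unit1 R) M)
  by now rewrite <- laxc_nat, fmap_id.
pose proof (lax_assoc_inv F M (dual D) M) as E3.
pose proof (f_equal (fmap (lax F)) (dual_triangle D)) as E6.
rewrite !fmap_comp in E6.
rewrite <- (lax_runit F M), <- (lax_lunit F M), <- E6.
rewrite !lwhisker_comp, !rwhisker_comp.
rewrite <- ?compose_assoc in E3.
rewrite <- ?compose_assoc.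
rewrite (compose_eq _ E1), compose_idl, (compose_eq _ E2), <- ?compose_assoc.
rewrite (compose_assoc (idm (lax F M) ⊡ laxc F (dual D) M) (assoc_inv _ _ _)), (compose_eq _ E3), <- ?compose_assoc.
rewrite (compose_eq _ E4), compose_idl, (compose_eq _ E5), <- ?compose_assoc.
reflexivity.
Qed.

Lemma image_triangle' (B C : Bicategory) (F : LaxFunctor B C) (R S : B)
  (M : cell R S) (D : RightDual M) (p : PreservesDual F D) :
  lunit (lax F (dual D)) ∘ (image_ev p ⊡ idm (lax F (dual D)))
    ∘ assoc (lax F (dual D)) (lax F M) (lax F (dual D))
    ∘ (idm (lax F (dual D)) ⊡ image_coev p)
  = runit (lax F (dual D)).
Proof.
unfold image_ev, image_coev.
destruct p as [[ci [Hc Hc']] [ii [Hi Hi']]]; simpl.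
set (N := dual D) in *.
assert (E1 : (laxi F S ⊡ idm (lax F N)) ∘ (ii ⊡ idm (lax F N)) = idm _)
  by now rewrite <- rwhisker_comp, Hi', odot2_id.
assert (E2 : laxc F (unit1 S) N ∘ (fmap (lax F) (ev D) ⊡ idm (lax F N))
             = fmap (lax F) (ev D ⊡ idm N) ∘ laxc F (N ⊙ M) N)
  by now rewrite <- laxc_nat, fmap_id.
assert (E4 : (idm (lax F N) ⊡ laxc F M N) ∘ (idm (lax F N) ⊡ ci) = idm _)
  by now rewrite <- lwhisker_comp, Hc', odot2_id.
assert (E5 : laxc F N (M ⊙ N) ∘ (idm (lax F N) ⊡ fmap (lax F) (coev D))
             = fmap (lax F) (idm N ⊡ coev D) ∘ laxc F N (unit1 R))
  by now rewrite <- laxc_nat, fmap_id.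
pose proof (lax_assoc F N M N) as E3.
pose proof (f_equal (fmap (lax F)) (dual_triangle' D)) as E6.
fold N in E6.
rewrite !fmap_comp in E6.
rewrite <- (lax_lunit F N), <- (lax_runit F N), <- E6.
rewrite !lwhisker_comp, !rwhisker_comp.
rewrite <- ?compose_assoc in E3.
rewrite <- ?compose_assoc.
rewrite (compose_eq _ E1), compose_idl, (compose_eq _ E2), <- ?compose_assoc.
rewrite (compose_assoc (laxc F N M ⊡ idm (lax F N)) (assoc _ _ _)), (compose_eq _ E3), <- ?compose_assoc.
rewrite (compose_eq _ E4), compose_idl, (compose_eq _ E5), <- ?compose_assoc.
reflexivity.
Qed.

Definition image_dual (B C : Bicategory) (F : LaxFunctor B C) (R S : B)
  (M : cell R S) (D : RightDual M) (p : PreservesDual F D) :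
  RightDual (lax F M) :=
  {| dual := lax F (dual D); coev := image_coev p; ev := image_ev p;
     dual_triangle := image_triangle p; dual_triangle' := image_triangle' p |}.

(** * Conjunctional transformations *)

(* The field [conj_unit] uses [lunit] and [runit] to identify
   [unit1 _ ⊙ conj1 R] with [conj1 R ⊙ unit1 _]. *)
Record Conjunctional (B C : Bicategory) (F G : LaxFunctor B C) := {
  conj1 : forall R : B, cell (F R) (G R);
  conj_dual : forall R : B, RightDual (conj1 R);
  conj2 : forall (R S : B) (M : cell R S),
    lax F M ⊙ conj1 S ⟶ conj1 R ⊙ lax G M;
  conj_nat : forall (R S : B) (M N : cell R S) (f : M ⟶ N),
    conj2 N ∘ (fmap (lax F) f ⊡ idm (conj1 S))
    = (idm (conj1 R) ⊡ fmap (lax G) f) ∘ conj2 M;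
  conj_unit : forall R : B,
    conj2 (unit1 R) ∘ (laxi F R ⊡ idm (conj1 R))
    = (idm (conj1 R) ⊡ laxi G R) ∘ runit_inv (conj1 R) ∘ lunit (conj1 R);
  conj_comp : forall (R S T : B) (M : cell R S) (N : cell S T),
    conj2 (M ⊙ N) ∘ (laxc F M N ⊡ idm (conj1 T))
    = (idm (conj1 R) ⊡ laxc G M N)
      ∘ assoc_inv (conj1 R) (lax G M) (lax G N)
      ∘ (conj2 M ⊡ idm (lax G N))
      ∘ assoc (lax F M) (conj1 S) (lax G N)
      ∘ (idm (lax F M) ⊡ conj2 N)
      ∘ assoc_inv (lax F M) (lax F N) (conj1 T)
}.

Arguments conj1 {_ _ _ _} _ _.
Arguments conj_dual {_ _ _ _} _ _.
Arguments conj2 {_ _ _ _} _ {_ _} _.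

(* Main.v *)
Require Import Defs.

(** A 1-cell [M] acts on every hom-category by [X ↦ X ⊙ M], and a 2-cell acts
    by natural maps.  Composites of such actions are associative and unital on
    the nose, so passing from 2-cells to the natural families they induce
    makes all constraints of the bicategory disappear, and nothing is lost,
    because the component at a unit determines the 2-cell ([strict_inj]).
    Below, [X] is the generic 1-cell acted upon.  A dual pair becomes an
    adjunction [X → X ⊙ M ⊙ M★], [X ⊙ M★ ⊙ M → X]; the axioms of a
    conjunctional transformation become equations between maps
    [X ⊙ F M ⊙ α → X ⊙ α ⊙ G M] without associators.

    Part (i).  The composition and unit axioms of [α], applied to [M ⊙ M★] and
    to the coevaluation, say that sliding [α] first past [F M★] and then past
    [F M] turns the coevaluation of [F M] into that of [G M] ([conj_coev]);
    dually for the evaluations ([conj_ev]).  Here the invertibility of [𝔠] and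
    of [𝔦] is what allows cancelling them.  Given these two facts, each
    composite of [α_M] with the mate of [α_(M★)] collapses, by naturality, to a
    triangle identity.

    Part (ii).  Traces are functorial for pasting squares: two successive
    traces, along [M] and then along [N], are the trace of the pasted square
    along [M ⊙ N] ([trace_paste]).  So one side is a trace along [F M ⊙ α_S],
    the other one along [α_R ⊙ G M].  The isomorphism [α_M] of part (i)
    intertwines the two pasted squares ([conj_square], from the composition
    axiom and naturality of [α]), and cyclicity of the trace makes it invariant
    under such a conjugation ([trace_conjugate]).

    For traces, the strictification is extended to shadows: [θ] becomes a
    rotation of cyclic words, whose hexagon axiom loses its associators
    ([rot_assoc]), and which is therefore an involution ([rot_rot]). *)

Set Implicit Arguments.
Unset Strict Implicit.
Unset Printing Implicit Defensive.

(** * Isomorphisms and whiskering *)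

Lemma iso_mono (X : Category) (A B C : X) (i : B ⟶ C) (I : is_iso i)
  (f g : A ⟶ B) : i ∘ f = i ∘ g -> f = g.
Proof.
destruct I as [j [Hj _]]; intros E.
rewrite <- (compose_idl f), <- (compose_idl g), <- Hj, <- !compose_assoc.
now f_equal.
Qed.

Lemma iso_epi (X : Category) (A B C : X) (i : A ⟶ B) (I : is_iso i)
  (f g : B ⟶ C) : f ∘ i = g ∘ i -> f = g.
Proof.
destruct I as [j [_ Hj]]; intros E.
rewrite <- (compose_idr f), <- (compose_idr g), <- Hj, !compose_assoc.
now f_equal.
Qed.

Definition idm_iso (X : Category) (A : X) : is_iso (idm A).
Proof. exists (idm A); split; apply compose_idl. Defined.

Definition compose_iso (X : Category) (A B C : X) (g : B ⟶ C) (f : A ⟶ B)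
  (J : is_iso g) (I : is_iso f) : is_iso (g ∘ f).
Proof.
exists (inv I ∘ inv J).
destruct I as [f' [Hf Hf']], J as [g' [Hg Hg']]; cbn; split.
- now rewrite <- compose_assoc, (compose_assoc g' g f), Hg, compose_idl.
- now rewrite <- compose_assoc, (compose_assoc f f' g'), Hf', compose_idl.
Defined.

Definition inv_iso (X : Category) (A B : X) (f : A ⟶ B)
  (I : is_iso f) : is_iso (inv I).
Proof. exists f; destruct I as [f' [Hf Hf']]; now split. Defined.

Definition rwhisker_iso (B : Bicategory) (R S T : B) (M M' : cell R S)
  (N : cell S T) (f : M ⟶ M') (I : is_iso f) : is_iso (f ⊡ idm N).
Proof.
exists (inv I ⊡ idm N).
destruct I as [f' [Hf Hf']]; cbn; split;
  rewrite <- rwhisker_comp, ?Hf, ?Hf'; apply odot2_id.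
Defined.

Definition lwhisker_iso (B : Bicategory) (R S T : B) (N : cell R S)
  (M M' : cell S T) (f : M ⟶ M') (I : is_iso f) : is_iso (idm N ⊡ f).
Proof.
exists (idm N ⊡ inv I).
destruct I as [f' [Hf Hf']]; cbn; split;
  rewrite <- lwhisker_comp, ?Hf, ?Hf'; apply odot2_id.
Defined.

Definition fmap_iso (X Y : Category) (F : Functor X Y) (A B : X) (f : A ⟶ B)
  (I : is_iso f) : is_iso (fmap F f).
Proof.
exists (fmap F (inv I)).
destruct I as [f' [Hf Hf']]; cbn; split;
  rewrite <- fmap_comp, ?Hf, ?Hf'; apply fmap_id.
Defined.

Lemma interchange (B : Bicategory) (R S T : B) (M M' : cell R S)
  (N N' : cell S T) (f : M ⟶ M') (g : N ⟶ N') :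
  (f ⊡ idm N') ∘ (idm M ⊡ g) = (idm M' ⊡ g) ∘ (f ⊡ idm N).
Proof. now rewrite <- !odot2_comp, !compose_idl, !compose_idr. Qed.

Lemma lwhisker_unit_inj (B : Bicategory) (R S : B) (M N : cell R S)
  (f g : M ⟶ N) : idm (unit1 R) ⊡ f = idm (unit1 R) ⊡ g -> f = g.
Proof.
intros E; apply (iso_epi (lunit_iso M)).
now rewrite <- !lunit_nat, E.
Qed.

Lemma rwhisker_unit_inj (B : Bicategory) (R S : B) (M N : cell R S)
  (f g : M ⟶ N) : f ⊡ idm (unit1 S) = g ⊡ idm (unit1 S) -> f = g.
Proof.
intros E; apply (iso_epi (runit_iso M)).
now rewrite <- !runit_nat, E.
Qed.

(** Kelly's observation that this unit triangle follows from the pentagon and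
    the middle triangle: after tensoring with a unit on the right, both sides
    occur in the pentagon for [M], [N] and two units. *)
Lemma runit_odot (B : Bicategory) (R S T : B) (M : cell R S) (N : cell S T) :
  runit (M ⊙ N) ∘ assoc M N (unit1 T) = idm M ⊡ runit N.
Proof.
apply rwhisker_unit_inj, (iso_epi (assoc_iso M (N ⊙ unit1 T) (unit1 T))).
apply (iso_epi (lwhisker_iso M (assoc_iso N (unit1 T) (unit1 T)))).
rewrite rwhisker_comp, <- !compose_assoc, <- pentagon.
rewrite compose_assoc, triangle.
rewrite (compose_assoc (_ ⊡ idm (unit1 T))), <- assoc_nat, <- compose_assoc,
  <- lwhisker_comp, triangle.
now rewrite assoc_nat, odot2_id.
Qed.

(** * Strictification of 2-cells *)

Section Words.
Variable B : Bicategory.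

(** Bracketed composites of 1-cells.  They record how a 1-cell is to be read as
    a composite, since this cannot be recovered from the 1-cell itself. *)
Inductive word : B -> B -> Type :=
| Leaf R S : cell R S -> word R S
| Unit R : word R R
| Comp R S T : word R S -> word S T -> word R T.

Fixpoint wcell R S (t : word R S) : cell R S :=
  match t with
  | Leaf M => M
  | Unit R => unit1 R
  | Comp t u => wcell t ⊙ wcell u
  end.

(** The left-bracketed composite of [X] with the letters of [t].  It forgets
    the brackets and units of [t] definitionally: two words with the same
    letters act by convertible functions, so that the equations below between
    different bracketings typecheck without transport. *)
Fixpoint act R S (t : word R S) : forall V, cell V R -> cell V S :=
  match t with
  | Leaf M => fun V X => X ⊙ M
  | Unit R => fun V X => X
  | Comp t u => fun V X => act u (act t X)
  end.

Fixpoint act2 R S (t : word R S) :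
  forall V (X Y : cell V R), (X ⟶ Y) -> (act t X ⟶ act t Y) :=
  match t with
  | Leaf M => fun V X Y h => h ⊡ idm M
  | Unit R => fun V X Y h => h
  | Comp t u => fun V X Y h => act2 u (act2 t h)
  end.

Fixpoint flatten R S (t : word R S) :
  forall V (X : cell V R), X ⊙ wcell t ⟶ act t X :=
  match t with
  | Leaf M => fun V X => idm _
  | Unit R => fun V X => runit X
  | Comp t u => fun V X =>
      flatten u (act t X) ∘ (flatten t X ⊡ idm (wcell u))
      ∘ assoc X (wcell t) (wcell u)
  end.

Fixpoint flatten_iso R S (t : word R S) :
  forall V (X : cell V R), is_iso (flatten t X) :=
  match t with
  | Leaf M => fun V X => idm_iso _
  | Unit R => fun V X => runit_iso X
  | Comp t u => fun V X =>
      compose_iso (flatten_iso u (act t X))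
        (compose_iso (rwhisker_iso (wcell u) (flatten_iso t X))
          (assoc_iso _ _ _))
  end.

Lemma act2_id R S (t : word R S) V (X : cell V R) :
  act2 t (idm X) = idm (act t X).
Proof.
revert V X; induction t; intros V X; cbn; auto.
- apply odot2_id.
- now rewrite IHt1, IHt2.
Qed.

Lemma flatten_nat R S (t : word R S) V (X Y : cell V R) (h : X ⟶ Y) :
  flatten t Y ∘ (h ⊡ idm (wcell t)) = act2 t h ∘ flatten t X.
Proof.
revert V X Y h; induction t; intros V X Y h; cbn.
- now rewrite compose_idl, compose_idr.
- apply runit_nat.
- rewrite <- !compose_assoc, <- odot2_id, assoc_nat.
  rewrite (compose_assoc (_ ⊡ idm (wcell t2)) (_ ⊡ idm (wcell t2))).
  rewrite <- rwhisker_comp, IHt1, rwhisker_comp, !compose_assoc, IHt2.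
  reflexivity.
Qed.

(** The family of maps induced by [f]; it is the conjugate of whiskering by the
    canonical isomorphisms. *)
Definition strict R S (t u : word R S) (f : wcell t ⟶ wcell u)
  V (X : cell V R) :
  act t X ⟶ act u X :=
  flatten u X ∘ (idm X ⊡ f) ∘ inv (flatten_iso t X).

Lemma strict_flatten R S (t u : word R S) (f : wcell t ⟶ wcell u)
  V (X : cell V R) :
  strict f X ∘ flatten t X = flatten u X ∘ (idm X ⊡ f).
Proof.
unfold strict; rewrite <- !compose_assoc.
now rewrite (proj1 (inv_spec (flatten_iso t X))), compose_idr.
Qed.

Lemma strictE R S (t u : word R S) (f : wcell t ⟶ wcell u) V (X : cell V R)
  (g : act t X ⟶ act u X) :
  flatten u X ∘ (idm X ⊡ f) = g ∘ flatten t X -> strict f X = g.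
Proof.
intros E; apply (iso_epi (flatten_iso t X)); now rewrite strict_flatten.
Qed.

(** The unit component suffices: whiskering with a unit is faithful. *)
Lemma strict_inj R S (t u : word R S) (f g : wcell t ⟶ wcell u) :
  strict f (unit1 R) = strict g (unit1 R) -> f = g.
Proof.
intros E; apply lwhisker_unit_inj, (iso_mono (flatten_iso u (unit1 R))).
now rewrite <- !strict_flatten, E.
Qed.

Lemma strict_nat R S (t u : word R S) (f : wcell t ⟶ wcell u)
  V (X Y : cell V R) (h : X ⟶ Y) :
  strict f Y ∘ act2 t h = act2 u h ∘ strict f X.
Proof.
apply (iso_epi (flatten_iso t X)).
rewrite <- !compose_assoc, strict_flatten, <- flatten_nat, !compose_assoc,
  strict_flatten, <- flatten_nat, <- !compose_assoc.
now rewrite interchange.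
Qed.

Lemma strict_id R S (t : word R S) V (X : cell V R) :
  strict (idm (wcell t)) X = idm (act t X).
Proof. apply strictE. now rewrite odot2_id, compose_idl, compose_idr. Qed.

Lemma strict_comp R S (t u v : word R S) (g : wcell u ⟶ wcell v)
  (f : wcell t ⟶ wcell u) V (X : cell V R) :
  strict (t := t) (u := v) (g ∘ f) X = strict g X ∘ strict f X.
Proof.
apply strictE.
now rewrite <- compose_assoc, strict_flatten, compose_assoc, strict_flatten,
  <- compose_assoc, lwhisker_comp.
Qed.

Lemma strict_odot2 R S T (t t' : word R S) (u u' : word S T)
  (f : wcell t ⟶ wcell t') (g : wcell u ⟶ wcell u') V (X : cell V R) :
  strict (t := Comp t u) (u := Comp t' u') (f ⊡ g) X
  = act2 u' (strict f X) ∘ strict g (act t X).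
Proof.
apply strictE; cbn.
rewrite <- !compose_assoc, assoc_nat.
rewrite (compose_assoc (strict g _)), strict_flatten, <- !compose_assoc.
rewrite (compose_assoc (idm (act t X) ⊡ g)), <- interchange, <- !compose_assoc.
rewrite (compose_assoc (act2 u' _)), <- flatten_nat, <- !compose_assoc.
f_equal; rewrite !compose_assoc, <- rwhisker_comp, strict_flatten; f_equal.
now rewrite <- !odot2_comp, !compose_idl, !compose_idr.
Qed.

(** With [strict_lunit] and [strict_runit], this is the coherence theorem in
    the form used here: the constraints act as identities. *)
Lemma strict_assoc Q R S T (t : word Q R) (u : word R S) (v : word S T)
  V (X : cell V Q) :
  strict (t := Comp t (Comp u v)) (u := Comp (Comp t u) v)
    (assoc (wcell t) (wcell u) (wcell v)) X = idm _.
Proof.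
apply strictE; rewrite compose_idl; cbn.
rewrite !rwhisker_comp, <- !compose_assoc, <- pentagon.
rewrite (compose_assoc (_ ⊡ idm (wcell v)) (assoc _ _ _)), <- assoc_nat,
  odot2_id.
now rewrite <- !compose_assoc.
Qed.

Lemma strict_lunit R S (t : word R S) V (X : cell V R) :
  strict (t := Comp (Unit R) t) (u := t) (lunit (wcell t)) X = idm _.
Proof. apply strictE; rewrite compose_idl; cbn. now rewrite triangle. Qed.

Lemma strict_runit R S (t : word R S) V (X : cell V R) :
  strict (t := Comp t (Unit S)) (u := t) (runit (wcell t)) X = idm _.
Proof.
apply strictE; rewrite compose_idl; cbn.
now rewrite compose_assoc, runit_nat, <- compose_assoc, runit_odot.
Qed.

Lemma strict_inv R S (t u : word R S) (f : wcell t ⟶ wcell u) (I : is_iso f)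
  V (X : cell V R) : strict (inv I) X ∘ strict f X = idm _.
Proof.
now rewrite <- strict_comp, (proj1 (inv_spec I)), strict_id.
Qed.

Lemma strict_assoc_inv Q R S T (t : word Q R) (u : word R S) (v : word S T)
  V (X : cell V Q) :
  strict (t := Comp (Comp t u) v) (u := Comp t (Comp u v))
    (assoc_inv (wcell t) (wcell u) (wcell v)) X = idm _.
Proof.
pose proof (strict_inv (t := Comp t (Comp u v)) (u := Comp (Comp t u) v)
  (assoc_iso _ _ _) X) as E.
rewrite strict_assoc in E; exact (eq_trans (eq_sym (compose_idr _)) E).
Qed.

Lemma strict_lunit_inv R S (t : word R S) V (X : cell V R) :
  strict (t := t) (u := Comp (Unit R) t) (lunit_inv (wcell t)) X = idm _.
Proof.
pose proof (strict_inv (t := Comp (Unit R) t) (u := t) (lunit_iso _) X) as E.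
rewrite strict_lunit in E; exact (eq_trans (eq_sym (compose_idr _)) E).
Qed.

Lemma strict_runit_inv R S (t : word R S) V (X : cell V R) :
  strict (t := t) (u := Comp t (Unit S)) (runit_inv (wcell t)) X = idm _.
Proof.
pose proof (strict_inv (t := Comp t (Unit S)) (u := t) (runit_iso _) X) as E.
rewrite strict_runit in E; exact (eq_trans (eq_sym (compose_idr _)) E).
Qed.

End Words.

(** Reads a 1-cell as a word; whatever is neither a composite nor a unit is a
    letter. *)
Ltac word_of c :=
  lazymatch c with
  | odot ?M ?N => let t := word_of M in let u := word_of N in constr:(Comp t u)
  | unit1 ?R => constr:(Unit R)
  | _ => constr:(Leaf c)
  end.

(* The equations are cast to have the matched subterm as their left-hand side,
   because the 1-cells [wcell t] in the lemmas and the 1-cells in the goal are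
   convertible but not syntactically equal. *)
Ltac strictify_step :=
  match goal with
  | |- context [@strict ?B ?R ?S ?t ?u0 ?e ?V ?X] =>
    let s := constr:(@strict B R S t u0 e V X) in
    let go E := (let E1 := constr:(E : s = _) in rewrite E1) in
    lazymatch e with
    | @compose _ _ ?m _ ?g ?f =>
        let u := word_of m in go (@strict_comp B R S t u u0 g f V X)
    | odot2 ?f ?g =>
        lazymatch t with Comp ?t1 ?t2 => lazymatch u0 with Comp ?u1 ?u2 =>
        go (@strict_odot2 _ _ _ _ t1 u1 t2 u2 f g _ X) end end
    | idm _ => go (@strict_id _ _ _ t _ X)
    | assoc _ _ _ => lazymatch t with Comp ?t (Comp ?u ?v) =>
      go (@strict_assoc _ _ _ _ _ t u v _ X) end
    | assoc_inv _ _ _ => lazymatch u0 with Comp ?t (Comp ?u ?v) =>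
      go (@strict_assoc_inv _ _ _ _ _ t u v _ X) end
    | lunit _ => go (@strict_lunit _ _ _ u0 _ X)
    | runit _ => go (@strict_runit _ _ _ u0 _ X)
    | lunit_inv _ => go (@strict_lunit_inv _ _ _ t _ X)
    | runit_inv _ => go (@strict_runit_inv _ _ _ t _ X)
    end
  end.

Ltac strict_simp :=
  cbn [act act2]; rewrite ?act2_id, ?odot2_id, ?compose_idl, ?compose_idr,
   <- ?compose_assoc.

Ltac strictify :=
  repeat (strictify_step; rewrite ?act2_id, ?compose_idl, ?compose_idr);
  repeat progress strict_simp.

(** Adds to the goal, as a premise, the strict form at [X] of the equation [E]
    between 2-cells. *)
Ltac strict_apply E X :=
 lazymatch type of E with
 | @eq (hom ?m ?n) ?f ?g =>
   let t := word_of m in let u := word_of n in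
   let H := fresh "H" in
   assert (H : strict (t := t) (u := u) f X = strict (t := t) (u := u) g X)
     by (now rewrite E);
   revert H; strictify
 end.

Lemma strict_leaf (B : Bicategory) (R S V : B) (M N : cell R S) (f : M ⟶ N)
  (X : cell V R) : strict (t := Leaf M) (u := Leaf N) f X = idm X ⊡ f.
Proof. apply strictE; cbn. now rewrite compose_idl, compose_idr. Qed.

(** * Dual pairs and mates, strictly *)

Section Families.
Variables (B : Bicategory) (V : B).

Definition coev_at (R S : B) (M : cell R S) (D : RightDual M) (X : cell V R) :
  X ⟶ X ⊙ M ⊙ dual D :=
  strict (t := Unit R) (u := Comp (Leaf M) (Leaf (dual D))) (coev D) X.

Definition ev_at (R S : B) (M : cell R S) (D : RightDual M) (X : cell V S) :
  X ⊙ dual D ⊙ M ⟶ X :=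
  strict (t := Comp (Leaf (dual D)) (Leaf M)) (u := Unit S) (ev D) X.

(** The strict form of a square [Q ⊙ M ⟶ N ⊙ P], the shape shared by the
    components of a conjunctional transformation and the 2-cells that are
    traced. *)
Definition slide (R S R' S' : B) (Q : cell R R') (M : cell R' S')
  (N : cell R S) (P : cell S S') (f : Q ⊙ M ⟶ N ⊙ P) (X : cell V R) :
  X ⊙ Q ⊙ M ⟶ X ⊙ N ⊙ P :=
  strict (t := Comp (Leaf Q) (Leaf M)) (u := Comp (Leaf N) (Leaf P)) f X.

Lemma coev_at_nat (R S : B) (M : cell R S) (D : RightDual M) (X Y : cell V R)
  (h : X ⟶ Y) :
  coev_at D Y ∘ h = (h ⊡ idm M ⊡ idm (dual D)) ∘ coev_at D X.
Proof.
exact (strict_nat (t := Unit R) (u := Comp (Leaf M) (Leaf (dual D))) (coev D) h).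
Qed.

Lemma ev_at_nat (R S : B) (M : cell R S) (D : RightDual M) (X Y : cell V S)
  (h : X ⟶ Y) :
  ev_at D Y ∘ (h ⊡ idm (dual D) ⊡ idm M) = h ∘ ev_at D X.
Proof.
exact (strict_nat (t := Comp (Leaf (dual D)) (Leaf M)) (u := Unit S) (ev D) h).
Qed.

Lemma slide_nat (R S R' S' : B) (Q : cell R R') (M : cell R' S')
  (N : cell R S) (P : cell S S') (f : Q ⊙ M ⟶ N ⊙ P) (X Y : cell V R)
  (h : X ⟶ Y) :
  slide f Y ∘ (h ⊡ idm Q ⊡ idm M) = (h ⊡ idm N ⊡ idm P) ∘ slide f X.
Proof.
exact (strict_nat (t := Comp (Leaf Q) (Leaf M))
  (u := Comp (Leaf N) (Leaf P)) f h).
Qed.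

(** The two triangle identities become those of the adjunction between
    [X ↦ X ⊙ M] and [Y ↦ Y ⊙ dual D]. *)
Lemma triangle_at (R S : B) (M : cell R S) (D : RightDual M) (X : cell V R) :
  ev_at D (X ⊙ M) ∘ (coev_at D X ⊡ idm M) = idm (X ⊙ M).
Proof. strict_apply (dual_triangle D) X. easy. Qed.

Lemma triangle_at' (R S : B) (M : cell R S) (D : RightDual M) (X : cell V S) :
  (ev_at D X ⊡ idm (dual D)) ∘ coev_at D (X ⊙ dual D) = idm (X ⊙ dual D).
Proof. strict_apply (dual_triangle' D) X. easy. Qed.

Lemma mate_slide (R S R' S' : B)
  (M : cell R S) (DM : RightDual M) (N : cell R' S') (DN : RightDual N)
  (X : cell R R') (Y : cell S S')
  (g : dual DM ⊙ X ⟶ Y ⊙ dual DN) (Z : cell V R) :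
  slide (mate g) Z
  = ev_at DN (Z ⊙ M ⊙ Y) ∘ (slide g (Z ⊙ M) ⊡ idm N)
    ∘ (coev_at DM Z ⊡ idm X ⊡ idm N).
Proof. unfold slide, mate; strictify. reflexivity. Qed.

End Families.

(** * Lax functors, strictly *)

Section LaxFamilies.
Variables (B C : Bicategory) (F : LaxFunctor B C) (V : C).

Definition laxc_at (R S T : B) (M : cell R S) (N : cell S T) (X : cell V (F R)) :
  X ⊙ lax F M ⊙ lax F N ⟶ X ⊙ lax F (M ⊙ N) :=
  strict (t := Comp (Leaf (lax F M)) (Leaf (lax F N)))
    (u := Leaf (lax F (M ⊙ N))) (laxc F M N) X.

Definition laxi_at (R : B) (X : cell V (F R)) : X ⟶ X ⊙ lax F (unit1 R) :=
  strict (t := Unit (F R)) (u := Leaf (lax F (unit1 R))) (laxi F R) X.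

(** The defining properties of the coevaluation and evaluation of an image dual
    pair, stated without the inverses of the constraints. *)
Lemma image_coev_at (R S : B) (M : cell R S) (D : RightDual M)
  (p : PreservesDual F D) (X : cell V (F R)) :
  laxc_at M (dual D) X ∘ coev_at (image_dual p) X
  = (idm X ⊡ fmap (lax F) (coev D)) ∘ laxi_at X.
Proof.
assert (E : laxc F M (dual D) ∘ image_coev p
            = fmap (lax F) (coev D) ∘ laxi F R).
{ unfold image_coev.
  now rewrite compose_assoc, (proj2 (inv_spec (pres_c p))), compose_idl. }
strict_apply E X. now rewrite strict_leaf.
Qed.

Lemma image_ev_at (R S : B) (M : cell R S) (D : RightDual M)
  (p : PreservesDual F D) (X : cell V (F S)) :
  laxi_at X ∘ ev_at (image_dual p) X
  = (idm X ⊡ fmap (lax F) (ev D)) ∘ laxc_at (dual D) M X.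
Proof.
assert (E : laxi F S ∘ image_ev p = fmap (lax F) (ev D) ∘ laxc F (dual D) M).
{ unfold image_ev.
  now rewrite compose_assoc, (proj2 (inv_spec (pres_i p))), compose_idl. }
strict_apply E X. now rewrite strict_leaf.
Qed.
End LaxFamilies.

Arguments laxc_at {_ _} _ {_ _ _ _} _ _ _.
Arguments laxi_at {_ _} _ {_ _} _.

Definition strict_iso (B : Bicategory) (R S : B) (t u : word R S)
  (f : wcell t ⟶ wcell u) (I : is_iso f) (V : B) (X : cell V R) :
  is_iso (strict f X) :=
  compose_iso (flatten_iso u X) (compose_iso (lwhisker_iso X I)
    (inv_iso (flatten_iso t X))).

(** * The component at a dualizable 1-cell is invertible *)

Section ConjFamilies.
Variables (B C : Bicategory) (F G : LaxFunctor B C) (alpha : Conjunctional F G).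
Variables (V : C).

Lemma conj_nat_at (R S : B) (M N : cell R S) (f : M ⟶ N) (X : cell V (F R)) :
  slide (conj2 alpha N) X ∘ ((idm X ⊡ fmap (lax F) f) ⊡ idm (conj1 alpha S))
  = (idm (X ⊙ conj1 alpha R) ⊡ fmap (lax G) f) ∘ slide (conj2 alpha M) X.
Proof. strict_apply (conj_nat alpha f) X. now rewrite !strict_leaf. Qed.

Lemma conj_unit_at (R : B) (X : cell V (F R)) :
  slide (conj2 alpha (unit1 R)) X ∘ (laxi_at F X ⊡ idm (conj1 alpha R))
  = laxi_at G (X ⊙ conj1 alpha R).
Proof. strict_apply (conj_unit alpha R) X. easy. Qed.

Lemma conj_comp_at (R S T : B) (M : cell R S) (N : cell S T) (X : cell V (F R)) :
  slide (conj2 alpha (M ⊙ N)) X ∘ (laxc_at F M N X ⊡ idm (conj1 alpha T))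
  = laxc_at G M N (X ⊙ conj1 alpha R)
    ∘ (slide (conj2 alpha M) X ⊡ idm (lax G N))
    ∘ slide (conj2 alpha N) (X ⊙ lax F M).
Proof. strict_apply (conj_comp alpha M N) X. easy. Qed.

Variables (R S : B) (M : cell R S) (D : RightDual M).
Variables (pF : PreservesDual F D) (pG : PreservesDual G D).

(** After composing with the invertible [𝔠] at [M ⊙ dual D], the left-hand side
    is [α] at [M ⊙ dual D] applied to the image of [coev D], and naturality
    and the unit axiom move the coevaluation to the other side of [α]. *)
Lemma conj_coev (X : cell V (F R)) :
  (slide (conj2 alpha M) X ⊡ idm _)
  ∘ slide (conj2 alpha (dual D)) (X ⊙ lax F M)
  ∘ (coev_at (image_dual pF) X ⊡ idm (conj1 alpha R))
  = coev_at (image_dual pG) (X ⊙ conj1 alpha R).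
Proof.
apply (iso_mono (strict_iso (t := Comp (Leaf _) (Leaf _)) (u := Leaf _)
  (pres_c pG) (X ⊙ conj1 alpha R))).
change (laxc_at G M (dual D) (X ⊙ conj1 alpha R) ∘
  (slide (conj2 alpha M) X ⊡ idm _)
  ∘ slide (conj2 alpha (dual D)) (X ⊙ lax F M)
  ∘ (coev_at (image_dual pF) X ⊡ idm (conj1 alpha R))
  = laxc_at G M (dual D) (X ⊙ conj1 alpha R)
    ∘ coev_at (image_dual pG) (X ⊙ conj1 alpha R)).
pose proof (conj_comp_at M (dual D) X) as E.
rewrite !compose_assoc in *. rewrite <- E, <- compose_assoc.
rewrite <- (rwhisker_comp _ (laxc_at F M (dual D) X)).
rewrite !image_coev_at, rwhisker_comp.
now rewrite compose_assoc, conj_nat_at, <- compose_assoc, conj_unit_at.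
Qed.

(** The same argument for the evaluation, where it is [𝔦] that is cancelled. *)
Lemma conj_ev (X : cell V (F S)) :
  ev_at (image_dual pG) (X ⊙ conj1 alpha S)
  ∘ (slide (conj2 alpha (dual D)) X ⊡ idm (lax G M))
  ∘ slide (conj2 alpha M) (X ⊙ lax F (dual D))
  = ev_at (image_dual pF) X ⊡ idm (conj1 alpha S).
Proof.
apply (iso_mono (strict_iso (t := Unit _) (u := Leaf _)
  (pres_i pG) (X ⊙ conj1 alpha S))).
change (laxi_at G (X ⊙ conj1 alpha S) ∘
  ev_at (image_dual pG) (X ⊙ conj1 alpha S)
  ∘ (slide (conj2 alpha (dual D)) X ⊡ idm (lax G M))
  ∘ slide (conj2 alpha M) (X ⊙ lax F (dual D))
  = laxi_at G (X ⊙ conj1 alpha S) ∘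
  (ev_at (image_dual pF) X ⊡ idm (conj1 alpha S))).
pose proof (conj_comp_at (dual D) M X) as E.
rewrite (compose_assoc (laxi_at G _)), image_ev_at, <- compose_assoc, <- E.
rewrite compose_assoc, <- conj_nat_at, <- compose_assoc, <- rwhisker_comp.
now rewrite <- (image_ev_at pF), rwhisker_comp, compose_assoc, conj_unit_at.
Qed.

Let mu := mate (DM := image_dual pF) (DN := image_dual pG) (conj2 alpha (dual D)).

(** Naturality brings [α_M] next to [α] at [dual D], where [conj_ev] trades the
    evaluation of [G M] for that of [F M]; a triangle identity remains. *)
Lemma mate_conj (X : cell V (F R)) :
  slide mu X ∘ slide (conj2 alpha M) X = idm _.
Proof.
unfold mu; rewrite mate_slide, <- !compose_assoc, <- slide_nat.
rewrite (compose_assoc (slide (conj2 alpha (dual D)) _ ⊡ _)), compose_assoc.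
cbn; rewrite conj_ev, <- rwhisker_comp.
pose proof (triangle_at (image_dual pF) X) as E; cbn in E.
rewrite E; apply odot2_id.
Qed.

(** Dually, naturality brings [α_M] next to [α] at [dual D], and [conj_coev]
    trades the coevaluations. *)
Lemma conj_mate (X : cell V (F R)) :
  slide (conj2 alpha M) X ∘ slide mu X = idm _.
Proof.
unfold mu; rewrite mate_slide, !compose_assoc, <- ev_at_nat.
rewrite <- !compose_assoc, <- !rwhisker_comp.
cbn. rewrite conj_coev. apply (triangle_at (image_dual pG)).
Qed.
End ConjFamilies.

Lemma slide_inj (B : Bicategory) (R S R' S' : B) (Q : cell R R')
  (M : cell R' S') (N : cell R S) (P : cell S S') (f g : Q ⊙ M ⟶ N ⊙ P) :
  slide f (unit1 R) = slide g (unit1 R) -> f = g.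
Proof.
exact (@strict_inj _ _ _ (Comp (Leaf Q) (Leaf M)) (Comp (Leaf N) (Leaf P)) f g).
Qed.

Lemma conj2_iso (B C : Bicategory) (F G : LaxFunctor B C)
  (alpha : Conjunctional F G) (R S : B) (M : cell R S) (D : RightDual M)
  (pF : PreservesDual F D) (pG : PreservesDual G D) :
  is_inverse (conj2 alpha M)
    (mate (DM := image_dual pF) (DN := image_dual pG) (conj2 alpha (dual D))).
Proof.
split.
- apply slide_inj; unfold slide; strictify. apply mate_conj.
- apply (@strict_inj _ _ _ (Comp (Leaf _) (Leaf _)) (Comp (Leaf _) (Leaf _))).
  strictify. apply conj_mate.
Qed.

(** * Rotation of cyclic words *)

Lemma inv_cancel (X : Category) (A B C : X) (i : A ⟶ B) (I : is_iso i)
  (h : A ⟶ C) : (h ∘ inv I) ∘ i = h.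
Proof. now rewrite <- compose_assoc, (proj1 (inv_spec I)), compose_idr. Qed.

Section Rotation.
Variables (B : Bicategory) (T : Category) (sh : Shadow B T).

Local Notation shact t := (shadow sh _ (act t (unit1 _))).

Definition sh_flatten R (t : word R R) : shadow sh R (wcell t) ⟶ shact t :=
  fmap (shadow sh R) (flatten t (unit1 R) ∘ lunit_inv (wcell t)).

Definition sh_flatten_iso R (t : word R R) : is_iso (sh_flatten t) :=
  fmap_iso (shadow sh R)
    (compose_iso (flatten_iso t (unit1 R)) (inv_iso (lunit_iso (wcell t)))).

(** The strict form of [θ], which moves the word [u] from the end of a cyclic
    word to its beginning. *)
Definition rot R S (t : word R S) (u : word S R) :
  shact (Comp t u) ⟶ shact (Comp u t) :=
  (sh_flatten (Comp u t) ∘ theta sh (wcell t) (wcell u))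
  ∘ inv (sh_flatten_iso (Comp t u)).

Lemma rot_sh_flatten R S (t : word R S) (u : word S R) :
  rot t u ∘ sh_flatten (Comp t u)
  = sh_flatten (Comp u t) ∘ theta sh (wcell t) (wcell u).
Proof.
apply inv_cancel.
Qed.

Lemma sh_flatten_nat R (t u : word R R) (f : wcell t ⟶ wcell u) :
  sh_flatten u ∘ fmap (shadow sh R) f
  = fmap (shadow sh R) (strict f (unit1 R)) ∘ sh_flatten t.
Proof.
unfold sh_flatten; rewrite <- !fmap_comp; f_equal.
rewrite compose_assoc, strict_flatten, <- !compose_assoc; f_equal.
apply (iso_epi (lunit_iso (wcell t))); rewrite <- !compose_assoc.
rewrite <- lunit_nat; unfold lunit_inv.
rewrite (compose_assoc _ (lunit (wcell u))),
  (proj1 (inv_spec (lunit_iso (wcell u)))).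
now rewrite (proj1 (inv_spec (lunit_iso (wcell t)))), compose_idl, compose_idr.
Qed.

(** Naturality of [θ], with both horizontal composites already in strict form.
    Taking for [f] and [g] composites with constraints also lets it regroup the
    letters of [t] and [u]. *)
Lemma rot_nat R S (t t' : word R S) (u u' : word S R)
  (f : wcell t ⟶ wcell t') (g : wcell u ⟶ wcell u') :
  rot t' u' ∘ fmap (shadow sh R)
    (act2 u' (strict f (unit1 R)) ∘ strict g (act t (unit1 R)))
  = fmap (shadow sh S) (act2 t' (strict g (unit1 S)) ∘ strict f (act u (unit1 S)))
    ∘ rot t u.
Proof.
rewrite <- (strict_odot2 (u' := u') f g), <- (strict_odot2 (u' := t') g f).
apply (iso_epi (sh_flatten_iso (Comp t u))).
rewrite <- !compose_assoc, rot_sh_flatten, <- sh_flatten_nat, compose_assoc,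
  rot_sh_flatten.
rewrite (compose_assoc (fmap (shadow sh S) _)).
transitivity ((sh_flatten (Comp u' t') ∘ fmap (shadow sh S) (g ⊡ f))
  ∘ theta sh (wcell t) (wcell u)).
- rewrite <- !compose_assoc; f_equal; apply theta_nat.
- f_equal; apply (sh_flatten_nat (t := Comp u t) (u := Comp u' t')).
Qed.

Lemma sh_flatten_assoc Q R S (t : word Q R) (u : word R S) (v : word S Q) :
  sh_flatten (Comp (Comp t u) v)
    ∘ fmap (shadow sh Q) (assoc (wcell t) (wcell u) (wcell v))
  = sh_flatten (Comp t (Comp u v)).
Proof.
eapply eq_trans;
  [apply (sh_flatten_nat (t := Comp t (Comp u v)) (u := Comp (Comp t u) v))|].
rewrite strict_assoc, fmap_id; apply compose_idl.
Qed.

Lemma sh_flatten_assoc_inv Q R S (t : word Q R) (u : word R S) (v : word S Q) :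
  sh_flatten (Comp t (Comp u v))
    ∘ fmap (shadow sh Q) (assoc_inv (wcell t) (wcell u) (wcell v))
  = sh_flatten (Comp (Comp t u) v).
Proof.
eapply eq_trans;
  [apply (sh_flatten_nat (t := Comp (Comp t u) v) (u := Comp t (Comp u v)))|].
rewrite strict_assoc_inv, fmap_id; apply compose_idl.
Qed.

Lemma sh_flatten_runit R (t : word R R) :
  sh_flatten t ∘ fmap (shadow sh R) (runit (wcell t))
  = sh_flatten (Comp t (Unit R)).
Proof.
eapply eq_trans; [apply (sh_flatten_nat (t := Comp t (Unit R)) (u := t))|].
rewrite strict_runit, fmap_id; apply compose_idl.
Qed.

Lemma sh_flatten_lunit R (t : word R R) :
  sh_flatten t ∘ fmap (shadow sh R) (lunit (wcell t))
  = sh_flatten (Comp (Unit R) t).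
Proof.
eapply eq_trans; [apply (sh_flatten_nat (t := Comp (Unit R) t) (u := t))|].
rewrite strict_lunit, fmap_id; apply compose_idl.
Qed.

(** The hexagon axiom: strictly, its associators are identities between words
    with the same letters. *)
Lemma rot_assoc R S V (t : word R S) (u : word S V) (v : word V R) :
  rot (Comp t u) v = rot u (Comp v t) ∘ rot t (Comp u v).
Proof.
apply (iso_epi (sh_flatten_iso (Comp (Comp t u) v))).
rewrite rot_sh_flatten.
pose (a := fmap (shadow sh S) (assoc_inv (wcell u) (wcell v) (wcell t))).
pose (b := fmap (shadow sh R) (assoc_inv (wcell t) (wcell u) (wcell v))).
transitivity (sh_flatten (Comp (Comp v t) u)
  ∘ (theta sh (wcell u) (wcell v ⊙ wcell t) ∘ a
     ∘ theta sh (wcell t) (wcell u ⊙ wcell v) ∘ b)).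
{ unfold a, b; rewrite <- theta_assoc, <- (sh_flatten_assoc v t u).
  symmetry; apply compose_assoc. }
rewrite compose_assoc.
transitivity ((rot u (Comp v t) ∘ sh_flatten (Comp u (Comp v t)))
  ∘ (a ∘ theta sh (wcell t) (wcell u ⊙ wcell v) ∘ b)).
{ f_equal; symmetry; exact (rot_sh_flatten u (Comp v t)). }
rewrite <- !compose_assoc; f_equal.
rewrite compose_assoc.
transitivity (sh_flatten (Comp (Comp u v) t)
  ∘ theta sh (wcell t) (wcell u ⊙ wcell v) ∘ b).
{ f_equal; apply sh_flatten_assoc_inv. }
rewrite compose_assoc.
transitivity ((rot t (Comp u v) ∘ sh_flatten (Comp t (Comp u v))) ∘ b).
{ f_equal; symmetry; exact (rot_sh_flatten t (Comp u v)). }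
rewrite <- compose_assoc; f_equal; apply sh_flatten_assoc_inv.
Qed.

Lemma rot_unit R (t : word R R) : rot t (Unit R) = idm _.
Proof.
apply (iso_epi (sh_flatten_iso (Comp t (Unit R)))).
rewrite rot_sh_flatten, <- (sh_flatten_lunit t).
transitivity (sh_flatten t ∘ (fmap (shadow sh R) (lunit (wcell t))
  ∘ theta sh (wcell t) (unit1 R))).
{ symmetry; apply compose_assoc. }
rewrite theta_runit, sh_flatten_runit; symmetry; apply compose_idl.
Qed.

Lemma rot_unit_comp R S (t : word R S) (u : word S R) :
  rot u (Comp (Unit R) t) = rot u t.
Proof.
pose proof (rot_nat (t := u) (t' := u) (u := Comp (Unit R) t) (u' := t)
  (idm (wcell u)) (lunit (wcell t))) as E.
rewrite !strict_lunit, !strict_id, !act2_id, !compose_idl, !fmap_id in E.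
exact (eq_sym (eq_trans (eq_sym (compose_idr _)) (eq_trans E (compose_idl _)))).
Qed.

Lemma rot_comp_unit R S (t : word R S) (u : word S R) :
  rot t (Comp u (Unit R)) = rot t u.
Proof.
pose proof (rot_nat (t := t) (t' := t) (u := Comp u (Unit R)) (u' := u)
  (idm (wcell t)) (runit (wcell u))) as E.
rewrite !strict_runit, !strict_id, !act2_id, !compose_idl, !fmap_id in E.
exact (eq_sym (eq_trans (eq_sym (compose_idr _)) (eq_trans E (compose_idl _)))).
Qed.

(** The hexagon with [v] empty: rotating by an empty word is the identity. *)
Lemma rot_rot R S (t : word R S) (u : word S R) :
  rot u t ∘ rot t u = idm _.
Proof.
pose proof (rot_assoc t u (Unit R)) as E.
rewrite (rot_unit (Comp t u)), rot_unit_comp, rot_comp_unit in E; exact (eq_sym E).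
Qed.

End Rotation.

Arguments sh_flatten {_ _} _ {_} _.
Arguments rot {_ _} _ {_ _} _ _.

(** * Traces, strictly *)

Lemma sh_flatten_nat_comp (B : Bicategory) (T : Category) (sh : Shadow B T)
  (R : B) (t u : word R R) (f : wcell t ⟶ wcell u)
  (Z : T) (r : Z ⟶ shadow sh R (wcell t)) :
  sh_flatten sh u ∘ (fmap (shadow sh R) f ∘ r)
  = fmap (shadow sh R) (strict f (unit1 R)) ∘ (sh_flatten sh t ∘ r).
Proof. now rewrite !compose_assoc, sh_flatten_nat. Qed.

Lemma rot_sh_flatten_comp (B : Bicategory) (T : Category) (sh : Shadow B T)
  (R S : B) (t : word R S) (u : word S R) (Z : T)
  (r : Z ⟶ shadow sh R (wcell t ⊙ wcell u)) :
  sh_flatten sh (Comp u t) ∘ (theta sh (wcell t) (wcell u) ∘ r)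
  = rot sh t u ∘ (sh_flatten sh (Comp t u) ∘ r).
Proof.
rewrite !compose_assoc. f_equal. symmetry; apply rot_sh_flatten.
Qed.

(* Moves [sh_flatten] rightwards through a composite of maps between shadows,
   replacing each map by its strict form. *)
Ltac shadow_step :=
  match goal with
  | |- context [@compose _ _ _ _ (@sh_flatten ?B ?T ?sh ?R ?u) ?e] =>
    let s := constr:(compose (@sh_flatten B T sh R u) e) in
    let go E := (let E1 := constr:(E : s = _) in rewrite E1) in
    lazymatch e with
    | @compose _ _ _ _ (@fmap _ _ _ ?x _ ?f) ?r =>
        let t := word_of x in go (@sh_flatten_nat_comp B T sh R t u f _ r)
    | @compose _ _ _ _ (@theta _ _ _ _ _ _ _) ?r =>
        lazymatch u with Comp ?u ?t =>
        go (@rot_sh_flatten_comp B T sh _ _ t u _ r) end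
    | @fmap _ _ _ ?x _ ?f =>
        let t := word_of x in go (@sh_flatten_nat B T sh R t u f)
    end
  end.

Definition strict_trace (B : Bicategory) (T : Category) (sh : Shadow B T)
  (R S : B) (M : cell R S) (D : RightDual M) (Q : cell R R) (P : cell S S)
  (f : Q ⊙ M ⟶ M ⊙ P) :
  shadow sh R (unit1 R ⊙ Q) ⟶ shadow sh S (unit1 S ⊙ P) :=
  fmap (shadow sh S) (ev_at D (unit1 S) ⊡ idm P)
  ∘ rot sh (Comp (Leaf M) (Leaf P)) (Leaf (dual D))
  ∘ fmap (shadow sh R) (slide f (unit1 R) ⊡ idm (dual D))
  ∘ fmap (shadow sh R) (coev_at D (unit1 R ⊙ Q)).

Lemma sh_flatten_trace (B : Bicategory) (T : Category) (sh : Shadow B T) (R S : B)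
  (M : cell R S) (D : RightDual M) (Q : cell R R) (P : cell S S)
  (f : Q ⊙ M ⟶ M ⊙ P) :
  sh_flatten sh (Leaf P) ∘ trace sh D f
  = strict_trace sh D f ∘ sh_flatten sh (Leaf Q).
Proof.
unfold trace, strict_trace; repeat shadow_step; strictify.
rewrite !fmap_id, !compose_idl; reflexivity.
Qed.

Lemma sh_flatten_trace_comp (B : Bicategory) (T : Category) (sh : Shadow B T)
  (R S V : B) (M : cell R S) (D : RightDual M) (N : cell S V) (E : RightDual N)
  (Q : cell R R) (P : cell S S) (L : cell V V)
  (f : Q ⊙ M ⟶ M ⊙ P) (g : P ⊙ N ⟶ N ⊙ L) :
  sh_flatten sh (Leaf L) ∘ (trace sh E g ∘ trace sh D f)
  = (strict_trace sh E g ∘ strict_trace sh D f) ∘ sh_flatten sh (Leaf Q).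
Proof.
eapply eq_trans; [apply compose_assoc|].
eapply eq_trans; [apply (f_equal (fun h => h ∘ _)), sh_flatten_trace|].
rewrite <- !compose_assoc; f_equal; apply sh_flatten_trace.
Qed.

(** * Traces along composites *)

Section CompDual.
Variables (B : Bicategory) (R S T : B) (M : cell R S) (N : cell S T).
Variables (DM : RightDual M) (DN : RightDual N).

Definition comp_coev : unit1 R ⟶ (M ⊙ N) ⊙ (dual DN ⊙ dual DM) :=
  assoc M N (dual DN ⊙ dual DM) ∘ (idm M ⊡ assoc_inv N (dual DN) (dual DM))
  ∘ (idm M ⊡ (coev DN ⊡ idm (dual DM))) ∘ (idm M ⊡ lunit_inv (dual DM))
  ∘ coev DM.

Definition comp_ev : (dual DN ⊙ dual DM) ⊙ (M ⊙ N) ⟶ unit1 T :=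
  ev DN ∘ (idm (dual DN) ⊡ lunit N)
  ∘ (idm (dual DN) ⊡ (ev DM ⊡ idm N))
  ∘ (idm (dual DN) ⊡ assoc (dual DM) M N)
  ∘ assoc_inv (dual DN) (dual DM) (M ⊙ N).

(** Strictly, this is the composite of two adjunctions: the inner pair, that of
    [N], is cancelled first, and then that of [M]. *)
Lemma comp_triangle :
  runit (M ⊙ N) ∘ (idm (M ⊙ N) ⊡ comp_ev)
    ∘ assoc_inv (M ⊙ N) (dual DN ⊙ dual DM) (M ⊙ N)
    ∘ (comp_coev ⊡ idm (M ⊙ N))
  = lunit (M ⊙ N).
Proof.
unfold comp_ev, comp_coev.
apply (@strict_inj _ _ _ (Comp (Unit R) (Comp (Leaf M) (Leaf N)))
  (Comp (Leaf M) (Leaf N))); strictify.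
set (X := unit1 R).
change (ev_at DN (X ⊙ M ⊙ N) ∘ (ev_at DM (X ⊙ M ⊙ N ⊙ dual DN) ⊡ idm N)
  ∘ (((coev_at DN (X ⊙ M) ⊡ idm (dual DM)) ∘ coev_at DM X)
     ⊡ idm M ⊡ idm N) = idm _).
rewrite <- rwhisker_comp, (rwhisker_comp M), compose_assoc, ev_at_nat.
rewrite <- compose_assoc, triangle_at, compose_idr; apply triangle_at.
Qed.

Lemma comp_triangle' :
  lunit (dual DN ⊙ dual DM) ∘ (comp_ev ⊡ idm (dual DN ⊙ dual DM))
    ∘ assoc (dual DN ⊙ dual DM) (M ⊙ N) (dual DN ⊙ dual DM)
    ∘ (idm (dual DN ⊙ dual DM) ⊡ comp_coev)
  = runit (dual DN ⊙ dual DM).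
Proof.
unfold comp_ev, comp_coev.
apply (@strict_inj _ _ _ (Comp (Comp (Leaf (dual DN)) (Leaf (dual DM))) (Unit R))
  (Comp (Leaf (dual DN)) (Leaf (dual DM)))); strictify.
set (X := unit1 T).
change (((ev_at DN X ∘ (ev_at DM (X ⊙ dual DN) ⊡ idm N))
    ⊡ idm (dual DN) ⊡ idm (dual DM))
  ∘ (coev_at DN (X ⊙ dual DN ⊙ dual DM ⊙ M) ⊡ idm (dual DM))
  ∘ coev_at DM (X ⊙ dual DN ⊙ dual DM) = idm _).
rewrite compose_assoc, <- rwhisker_comp, (rwhisker_comp (dual DN)).
rewrite <- compose_assoc, <- coev_at_nat.
rewrite compose_assoc, triangle_at', compose_idl; apply triangle_at'.
Qed.

Definition comp_dual : RightDual (M ⊙ N) :=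
  {| dual := dual DN ⊙ dual DM; coev := comp_coev; ev := comp_ev;
     dual_triangle := comp_triangle; dual_triangle' := comp_triangle' |}.

End CompDual.

(** The pasting of two squares side by side. *)
Definition paste (B : Bicategory) (R S T : B) (M : cell R S) (N : cell S T)
  (Q : cell R R) (P : cell S S) (L : cell T T)
  (f : Q ⊙ M ⟶ M ⊙ P) (g : P ⊙ N ⟶ N ⊙ L) : Q ⊙ (M ⊙ N) ⟶ (M ⊙ N) ⊙ L :=
  assoc M N L ∘ (idm M ⊡ g) ∘ assoc_inv M P N ∘ (f ⊡ idm N) ∘ assoc Q M N.

(** On the left, [M] and its dual are contracted before [N] and its dual are
    created.  Sliding the contraction to the end lets [N] be created first, and
    the two rotations, by [dual DM] and then by [dual DN], compose to a single
    rotation by [dual DN ⊙ dual DM]. *)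
Lemma strict_trace_paste (B : Bicategory) (C : Category) (sh : Shadow B C)
  (R S T : B) (M : cell R S) (N : cell S T)
  (DM : RightDual M) (DN : RightDual N)
  (Q : cell R R) (P : cell S S) (L : cell T T)
  (f : Q ⊙ M ⟶ M ⊙ P) (g : P ⊙ N ⟶ N ⊙ L) :
  strict_trace sh DN g ∘ strict_trace sh DM f
  = fmap (shadow sh T)
      ((ev_at DN (unit1 T) ∘ (ev_at DM (unit1 T ⊙ dual DN) ⊡ idm N)) ⊡ idm L)
    ∘ rot sh (Comp (Comp (Leaf M) (Leaf N)) (Leaf L))
        (Comp (Leaf (dual DN)) (Leaf (dual DM)))
    ∘ fmap (shadow sh R)
        ((slide g (unit1 R ⊙ M) ∘ (slide f (unit1 R) ⊡ idm N))
          ⊡ idm (dual DN) ⊡ idm (dual DM))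
    ∘ fmap (shadow sh R)
        ((coev_at DN (unit1 R ⊙ Q ⊙ M) ⊡ idm (dual DM))
          ∘ coev_at DM (unit1 R ⊙ Q)).
Proof.
set (w := Comp (Comp (Leaf M) (Leaf N)) (Leaf L)).
set (n := Leaf (dual DN)). set (m := Leaf (dual DM)).
(* [E1] delays the contraction of [M] past the second rotation. *)
assert (E1 : rot sh (Comp (Leaf N) (Leaf L)) n
    ∘ fmap (shadow sh S) (ev_at DM (unit1 S) ⊡ idm N ⊡ idm L ⊡ idm (dual DN))
  = fmap (shadow sh T) (ev_at DM (unit1 T ⊙ dual DN) ⊡ idm N ⊡ idm L)
    ∘ rot sh (Comp m w) n).
{ pose (e := lunit (N ⊙ L) ∘ (ev DM ⊡ idm (N ⊙ L))
    ∘ assoc (dual DM) M (N ⊙ L) ∘ (idm (dual DM) ⊡ assoc_inv M N L)).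
  generalize (rot_nat sh (t := Comp m w) (t' := Comp (Leaf N) (Leaf L))
    (u := n) (u' := n) e (idm (dual DN))).
  unfold e, m, n, w; strictify; easy. }
(* [E2] advances the creation of [N] and the square [g] before the first
   rotation. *)
assert (E2 : rot sh (Comp w n) m
    ∘ fmap (shadow sh R)
       (((slide g (unit1 R ⊙ M) ⊡ idm (dual DN)) ∘ coev_at DN (unit1 R ⊙ M ⊙ P))
        ⊡ idm (dual DM))
  = fmap (shadow sh S)
      ((slide g (unit1 S ⊙ dual DM ⊙ M) ⊡ idm (dual DN))
       ∘ coev_at DN (unit1 S ⊙ dual DM ⊙ M ⊙ P))
    ∘ rot sh (Comp (Leaf M) (Leaf P)) m).
{ pose (e := ((assoc M N L ∘ (idm M ⊡ g) ∘ assoc_inv M P N) ⊡ idm (dual DN))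
    ∘ assoc (M ⊙ P) N (dual DN) ∘ (idm (M ⊙ P) ⊡ coev DN) ∘ runit_inv (M ⊙ P)).
  generalize (rot_nat sh (t := Comp (Leaf M) (Leaf P)) (t' := Comp w n)
    (u := m) (u' := m) e (idm (dual DM))).
  unfold e, m, n, w; strictify; easy. }
(* By the hexagon, rotating by [n] and [m] together differs from rotating by
   [m] alone by a rotation that the involutivity of [rot] undoes. *)
assert (E3 : rot sh w (Comp n m) = rot sh (Comp m w) n ∘ rot sh (Comp w n) m).
{ rewrite (rot_assoc sh w n m), compose_assoc.
  symmetry; eapply eq_trans; [|apply compose_idl].
  exact (f_equal (fun h => h ∘ rot sh w (Comp n m)) (rot_rot sh n (Comp m w))). }
assert (E4 : (slide g (unit1 S) ⊡ idm (dual DN)) ∘ coev_at DN (unit1 S ⊙ P)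
    ∘ (ev_at DM (unit1 S) ⊡ idm P)
  = (ev_at DM (unit1 S) ⊡ idm N ⊡ idm L ⊡ idm (dual DN))
    ∘ (slide g (unit1 S ⊙ dual DM ⊙ M) ⊡ idm (dual DN))
    ∘ coev_at DN (unit1 S ⊙ dual DM ⊙ M ⊙ P)).
{ rewrite coev_at_nat, !compose_assoc, <- !rwhisker_comp, slide_nat; reflexivity. }
assert (E5 : ((slide g (unit1 R ⊙ M) ∘ (slide f (unit1 R) ⊡ idm N))
          ⊡ idm (dual DN) ⊡ idm (dual DM))
    ∘ (coev_at DN (unit1 R ⊙ Q ⊙ M) ⊡ idm (dual DM))
  = (((slide g (unit1 R ⊙ M) ⊡ idm (dual DN)) ∘ coev_at DN (unit1 R ⊙ M ⊙ P))
        ⊡ idm (dual DM))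
    ∘ (slide f (unit1 R) ⊡ idm (dual DM))).
{ rewrite <- !rwhisker_comp; f_equal.
  now rewrite <- compose_assoc, coev_at_nat, compose_assoc, <- rwhisker_comp. }
rewrite E3; unfold strict_trace; subst n m w; cbn [act] in *.
rewrite (rwhisker_comp L), !fmap_comp, <- !compose_assoc.
apply (f_equal (fmap (shadow sh R))) in E5.
apply (f_equal (fmap (shadow sh S))) in E4.
rewrite !fmap_comp in E2; rewrite !fmap_comp in E5.
rewrite !fmap_comp, compose_assoc in E4.
rewrite (compose_eq _ E5), <- !compose_assoc, (compose_eq _ E2).
rewrite <- !compose_assoc, (compose_eq _ (eq_sym E1)), <- !compose_assoc.
do 2 f_equal; rewrite !compose_assoc in *; now rewrite E4.
Qed.

Lemma trace_paste (B : Bicategory) (C : Category) (sh : Shadow B C)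
  (R S T : B) (M : cell R S) (N : cell S T)
  (DM : RightDual M) (DN : RightDual N)
  (Q : cell R R) (P : cell S S) (L : cell T T)
  (f : Q ⊙ M ⟶ M ⊙ P) (g : P ⊙ N ⟶ N ⊙ L) :
  trace sh DN g ∘ trace sh DM f = trace sh (comp_dual DM DN) (paste f g).
Proof.
apply (iso_mono (sh_flatten_iso sh (Leaf L))).
rewrite sh_flatten_trace_comp.
unfold trace, paste; cbn [comp_dual dual coev ev].
unfold comp_ev, comp_coev.
repeat shadow_step; strictify.
rewrite !fmap_id, !compose_idl, !compose_assoc; f_equal.
rewrite <- !compose_assoc; apply strict_trace_paste.
Qed.

(** * Cyclicity of the trace *)

Section Cyclicity.
Variables (B : Bicategory) (R S : B) (M N : cell R S).
Variables (DM : RightDual M) (DN : RightDual N).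

(** The mate of [k] under the two dual pairs. *)
Definition dual2 (k : M ⟶ N) : dual DN ⟶ dual DM :=
  lunit (dual DM) ∘ (ev DN ⊡ idm (dual DM))
  ∘ assoc (dual DN) N (dual DM) ∘ (idm (dual DN) ⊡ (k ⊡ idm (dual DM)))
  ∘ (idm (dual DN) ⊡ coev DM) ∘ runit_inv (dual DN).

Lemma dual2_at (k : M ⟶ N) (V : B) (X : cell V S) :
  idm X ⊡ dual2 k
  = (ev_at DN X ⊡ idm (dual DM))
    ∘ ((idm (X ⊙ dual DN) ⊡ k) ⊡ idm (dual DM)) ∘ coev_at DM (X ⊙ dual DN).
Proof.
rewrite <- !strict_leaf; unfold dual2; strictify. reflexivity.
Qed.

(** This and [ev_dual2] characterize [dual2 k]: it may replace [k] next to a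
    coevaluation or an evaluation. *)
Lemma coev_dual2 (k : M ⟶ N) (V : B) (X : cell V R) :
  ((idm X ⊡ k) ⊡ idm (dual DM)) ∘ coev_at DM X
  = (idm (X ⊙ N) ⊡ dual2 k) ∘ coev_at DN X.
Proof.
rewrite dual2_at, <- !compose_assoc, coev_at_nat.
rewrite (compose_assoc ((idm (X ⊙ N ⊙ dual DN) ⊡ k) ⊡ idm (dual DM))).
rewrite <- rwhisker_comp, <- interchange, rwhisker_comp.
rewrite !compose_assoc, <- rwhisker_comp, triangle_at, odot2_id.
now rewrite compose_idl.
Qed.

Lemma ev_dual2 (k : M ⟶ N) (V : B) (X : cell V S) :
  ev_at DM X ∘ ((idm X ⊡ dual2 k) ⊡ idm M)
  = ev_at DN X ∘ (idm (X ⊙ dual DN) ⊡ k).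
Proof.
rewrite dual2_at, !rwhisker_comp, !compose_assoc, ev_at_nat.
rewrite <- (compose_assoc (ev_at DN X)), ev_at_nat.
rewrite <- !compose_assoc, triangle_at, compose_idr; reflexivity.
Qed.

Variables (T : Category) (sh : Shadow B T).

(** [k] travels once around the cyclic word: it crosses the coevaluation as
    [dual2 k], is rotated to the front, and becomes [k] again at the
    evaluation. *)
Lemma strict_trace_cyclic (Q : cell R R) (P : cell S S) (k : M ⟶ N)
  (f : Q ⊙ N ⟶ M ⊙ P) :
  strict_trace sh DM (f ∘ (idm Q ⊡ k)) = strict_trace sh DN ((k ⊡ idm P) ∘ f).
Proof.
unfold strict_trace.
assert (E1 : slide (f ∘ (idm Q ⊡ k)) (unit1 R)
  = slide f (unit1 R) ∘ (idm (unit1 R ⊙ Q) ⊡ k)).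
{ unfold slide; strictify; now rewrite strict_leaf. }
assert (E2 : slide ((k ⊡ idm P) ∘ f) (unit1 R)
  = ((idm (unit1 R) ⊡ k) ⊡ idm P) ∘ slide f (unit1 R)).
{ unfold slide; strictify; now rewrite strict_leaf. }
pose (wM := Comp (Leaf M) (Leaf P)). pose (wN := Comp (Leaf N) (Leaf P)).
assert (E3 : rot sh wM (Leaf (dual DM))
    ∘ fmap (shadow sh R) (idm (unit1 R ⊙ M ⊙ P) ⊡ dual2 k)
  = fmap (shadow sh S) ((idm (unit1 S) ⊡ dual2 k) ⊡ idm M ⊡ idm P)
    ∘ rot sh wM (Leaf (dual DN))).
{ generalize (rot_nat sh (t := wM) (t' := wM)
    (u := Leaf (dual DN)) (u' := Leaf (dual DM)) (idm (M ⊙ P)) (dual2 k)).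
  unfold wM; strictify; rewrite !strict_leaf; easy. }
assert (E4 : rot sh wN (Leaf (dual DN))
    ∘ fmap (shadow sh R) ((idm (unit1 R) ⊡ k) ⊡ idm P ⊡ idm (dual DN))
  = fmap (shadow sh S) ((idm (unit1 S ⊙ dual DN) ⊡ k) ⊡ idm P)
    ∘ rot sh wM (Leaf (dual DN))).
{ generalize (rot_nat sh (t := wM) (t' := wN)
    (u := Leaf (dual DN)) (u' := Leaf (dual DN)) (k ⊡ idm P) (idm (dual DN))).
  unfold wM, wN; strictify; rewrite !strict_leaf; easy. }
subst wM wN; cbn [act] in *.
rewrite E1, E2, !rwhisker_comp, !fmap_comp, <- !compose_assoc.
rewrite (compose_eq _ E4), <- !compose_assoc.
rewrite <- (fmap_comp (shadow sh R) _ (coev_at DM _)), coev_dual2, fmap_comp.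
rewrite (compose_assoc (fmap _ (slide f (unit1 R) ⊡ _))).
rewrite <- (fmap_comp (shadow sh R) (slide f (unit1 R) ⊡ _)), interchange.
rewrite fmap_comp, <- !compose_assoc, (compose_eq _ E3), <- !compose_assoc.
rewrite !compose_assoc, <- !fmap_comp, <- !rwhisker_comp.
now rewrite ev_dual2.
Qed.
End Cyclicity.

Lemma trace_cyclic (B : Bicategory) (T : Category) (sh : Shadow B T)
  (R S : B) (M N : cell R S) (DM : RightDual M) (DN : RightDual N)
  (Q : cell R R) (P : cell S S) (k : M ⟶ N) (f : Q ⊙ N ⟶ M ⊙ P) :
  trace sh DM (f ∘ (idm Q ⊡ k)) = trace sh DN ((k ⊡ idm P) ∘ f).
Proof.
apply (iso_mono (sh_flatten_iso sh (Leaf P))).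
eapply eq_trans; [apply sh_flatten_trace|].
eapply eq_trans; [|symmetry; apply sh_flatten_trace].
f_equal; apply strict_trace_cyclic.
Qed.

(** Insert [h] and its inverse before [f] and move [h] around the trace. *)
Lemma trace_conjugate (B : Bicategory) (T : Category) (sh : Shadow B T)
  (R S : B) (M N : cell R S) (DM : RightDual M) (DN : RightDual N)
  (Q : cell R R) (P : cell S S) (f : Q ⊙ M ⟶ M ⊙ P) (g : Q ⊙ N ⟶ N ⊙ P)
  (h : M ⟶ N) (I : is_iso h) :
  (h ⊡ idm P) ∘ f = g ∘ (idm Q ⊡ h) -> trace sh DM f = trace sh DN g.
Proof.
intros E; destruct I as [k [kh hk]].
transitivity (trace sh DM ((f ∘ (idm Q ⊡ k)) ∘ (idm Q ⊡ h))).
- f_equal.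
  now rewrite <- compose_assoc, <- lwhisker_comp, kh, odot2_id, compose_idr.
- rewrite (trace_cyclic sh DM DN); f_equal.
  rewrite compose_assoc, E, <- compose_assoc, <- lwhisker_comp, hk, odot2_id.
  apply compose_idr.
Qed.

(** * Intertwining the two pasted squares *)

Lemma image2_at (B C : Bicategory) (F : LaxFunctor B C) (V : C) (R S : B)
  (M : cell R S) (Q : cell R R) (P : cell S S) (I : is_iso (laxc F M P))
  (f : Q ⊙ M ⟶ M ⊙ P) (X : cell V (F R)) :
  laxc_at F M P X ∘ slide (inv I ∘ fmap (lax F) f ∘ laxc F Q M) X
  = (idm X ⊡ fmap (lax F) f) ∘ laxc_at F Q M X.
Proof.
pose (e := inv I ∘ fmap (lax F) f ∘ laxc F Q M).
assert (E : laxc F M P ∘ e = fmap (lax F) f ∘ laxc F Q M).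
{ unfold e. now rewrite compose_assoc, (proj2 (inv_spec I)), compose_idl. }
fold e; strict_apply E X. now rewrite strict_leaf.
Qed.

(** Composing with the invertible [𝔠] at [M] and [P] turns both sides into [α]
    at [M ⊙ P] after [F f], or equivalently [G f] after [α] at [Q ⊙ M]. *)
Lemma conj_square (B C : Bicategory) (F G : LaxFunctor B C)
  (alpha : Conjunctional F G) (R S : B) (M : cell R S)
  (P : cell S S) (Q : cell R R) (f : Q ⊙ M ⟶ M ⊙ P)
  (cF : is_iso (laxc F M P)) (cG : is_iso (laxc G M P)) :
  (conj2 alpha M ⊡ idm (lax G P))
  ∘ paste (inv cF ∘ fmap (lax F) f ∘ laxc F Q M) (conj2 alpha P)
  = paste (conj2 alpha Q) (inv cG ∘ fmap (lax G) f ∘ laxc G Q M)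
    ∘ (idm (lax F Q) ⊡ conj2 alpha M).
Proof.
set (fF := inv cF ∘ _); set (fG := inv cG ∘ _).
apply (@strict_inj _ _ _ (Comp (Leaf _) (Comp (Leaf _) (Leaf _)))
  (Comp (Comp (Leaf _) (Leaf _)) (Leaf _))).
unfold paste; strictify.
set (X := unit1 (F R)).
change ((slide (conj2 alpha M) X ⊡ idm (lax G P))
  ∘ slide (conj2 alpha P) (X ⊙ lax F M) ∘ (slide fF X ⊡ idm (conj1 alpha S))
  = slide fG (X ⊙ conj1 alpha R) ∘ (slide (conj2 alpha Q) X ⊡ idm (lax G M))
    ∘ slide (conj2 alpha M) (X ⊙ lax F Q)).
apply (iso_mono (strict_iso (t := Comp (Leaf _) (Leaf _)) (u := Leaf _)
  cG (X ⊙ conj1 alpha R))).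
pose proof (conj_comp_at alpha M P X) as E.
pose proof (conj_comp_at alpha Q M X) as E'.
pose proof (image2_at cF f X) as EF; fold fF in EF.
pose proof (image2_at cG f (X ⊙ conj1 alpha R)) as EG; fold fG in EG.
change (laxc_at G M P (X ⊙ conj1 alpha R)
  ∘ (slide (conj2 alpha M) X ⊡ idm (lax G P))
  ∘ slide (conj2 alpha P) (X ⊙ lax F M) ∘ (slide fF X ⊡ idm (conj1 alpha S))
  = laxc_at G M P (X ⊙ conj1 alpha R)
  ∘ slide fG (X ⊙ conj1 alpha R) ∘ (slide (conj2 alpha Q) X ⊡ idm (lax G M))
    ∘ slide (conj2 alpha M) (X ⊙ lax F Q)).
rewrite (compose_eq _ EG), <- compose_assoc, <- E', compose_assoc.
rewrite !compose_assoc in *. rewrite <- E, <- conj_nat_at.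
now rewrite <- !compose_assoc, <- !rwhisker_comp, EF.
Qed.

Theorem theorem9p4
  (B C : Bicategory) (TB TC : Category)
  (shB : Shadow B TB) (shC : Shadow C TC)
  (F G : LaxFunctor B C) (alpha : Conjunctional F G)
  (R S : B) (M : cell R S) (D : RightDual M)
  (pF : PreservesDual F D) (pG : PreservesDual G D) :
  (exists I : is_iso (conj2 alpha M),
     inv I = mate (DM := image_dual pF) (DN := image_dual pG)
                  (conj2 alpha (dual D)))
  /\
  (forall (P : cell S S)
     (cF : is_iso (laxc F M P)) (cG : is_iso (laxc G M P))
     (Q : cell R R) (f : Q ⊙ M ⟶ M ⊙ P),
     trace shC (conj_dual alpha S) (conj2 alpha P)
       ∘ trace shC (image_dual pF)
           (inv cF ∘ fmap (lax F) f ∘ laxc F Q M)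
     = trace shC (image_dual pG)
           (inv cG ∘ fmap (lax G) f ∘ laxc G Q M)
       ∘ trace shC (conj_dual alpha R) (conj2 alpha Q)).
Proof.
pose (I := Build_is_iso (conj2_iso alpha pF pG)).
split.
- now exists I.
- intros P cF cG Q f; rewrite !trace_paste.
  apply (trace_conjugate _ _ _ I), conj_square.
Qed.
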